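(* Let $Y=(y_1,\dots,y_N)$ be a tuple of $N\in\mathbb{N}$ distinct points in $\mathbb{R}^3$. For $a\in\overline{\mathbb{R}}^N$ let $D=D_a$ be the regularized determinant and $b\in\mathbb{C}^N$ the point associated with $a$ (see context). (i) If $k$ and $a\in\overline{\mathbb{R}}^N$ are of minimal decay over $\mathbb{F}_{\overline{\mathbb{R}}}$ for the frequency $\mathrm{Re}\,k$, then there exists $\xi\in[-\pi,\pi)$ such that $\partial_{\beta_j}D(b;k)$ belongs to the ray $e^{\mathrm{i}\xi}[0,+\infty)$ for all $j=1,\dots,N$. (ii) If $a\in\overline{\mathbb{R}}^N$ and $k\in\Sigma_{\mathrm{res}}(a,Y)$ are such that $k\in\mathrm{bd}\,\Sigma_{\mathrm{res}}[\mathbb{F}_{\overline{\mathbb{R}}}]$ (boundary in $\mathbb{C}$), then there exists $\xi\in[-\pi,\pi)$ such that $\partial_{\beta_j}D(b;k)$ belongs to the line $e^{\mathrm{i}\xi}\mathbb{R}$ for all $j=1,\dots,N$.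
   Context: Notation: $\mathbb{C}_-=\{z\in\mathbb{C}:\mathrm{Im}\,z<0\}$, $\overline{\mathbb{C}}=\mathbb{C}\cup\{\infty\}$, $\overline{\mathbb{R}}=\mathbb{R}\cup\{\infty\}$. For $x\in\mathbb{R}^3\setminus\{0\}$ and $z\in\mathbb{C}$ put $G_z(x)=\frac{e^{\mathrm{i}z|x|}}{4\pi|x|}$, and let $\widetilde G_z(x)=G_z(x)$ for $x\ne0$, $\widetilde G_z(0)=0$. For $\alpha\in\mathbb{C}^N$, $\Gamma_{\alpha,Y}(z)$ is the $N\times N$ matrix with entries $(\alpha_j-\frac{\mathrm{i}z}{4\pi})\delta_{jj'}-\widetilde G_z(y_j-y_{j'})$. For $\alpha\in\overline{\mathbb{C}}^N$ one sets $\det\Gamma_{\alpha,Y}(z):=\det\Gamma_{\widetilde\alpha,\widetilde Y}(z)$, where $\widetilde\alpha,\widetilde Y$ are obtained from $\alpha,Y$ by deleting the components with indices $j$ such that $\alpha_j=\infty$ (the determinant of the empty matrix is $1$). $\Sigma(\alpha,Y)\subset\mathbb{C}$ denotes the set of zeros of $\det\Gamma_{\alpha,Y}(\cdot)$, and $\Sigma_{\mathrm{res}}(\alpha,Y):=\Sigma(\alpha,Y)\cap(\mathbb{C}_-\cup\mathbb{R})$ is the set of resonances of the point-interaction Hamiltonian $H_\alpha=-\Delta_{\alpha,Y}$. $\mathbb{F}_{\overline{\mathbb{R}}}=\{H_\alpha:\alpha\in\overline{\mathbb{R}}^N\}$ and $\Sigma_{\mathrm{res}}[\mathbb{F}_{\overline{\mathbb{R}}}]=\bigcup_{\alpha\in\overline{\mathbb{R}}^N}\Sigma_{\mathrm{res}}(\alpha,Y)$.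 A real $f$ is an achievable frequency over $\mathbb{F}_{\overline{\mathbb{R}}}$ if $f=\mathrm{Re}\,k$ for some $k\in\Sigma_{\mathrm{res}}[\mathbb{F}_{\overline{\mathbb{R}}}]$; then $\mathfrak{r}_{\min}(f;\mathbb{F}_{\overline{\mathbb{R}}}):=\inf\{\mathfrak{r}\in[0,+\infty): f-\mathrm{i}\mathfrak{r}\in\Sigma_{\mathrm{res}}[\mathbb{F}_{\overline{\mathbb{R}}}]\}$. One says that $k$ and $a\in\overline{\mathbb{R}}^N$ are of minimal decay over $\mathbb{F}_{\overline{\mathbb{R}}}$ for the frequency $f$ if $k=f-\mathrm{i}\,\mathfrak{r}_{\min}(f;\mathbb{F}_{\overline{\mathbb{R}}})$ and $k\in\Sigma_{\mathrm{res}}(a,Y)$. Regularized determinant: given $a\in\overline{\mathbb{C}}^N$, let $n(a)$ be the number of $j$ with $a_j\ne\infty$, and $D_a(\beta;z)=(-1)^{n(a)}\det[M_{jj'}]_{j,j'=1}^N$ for $\beta\in\mathbb{C}^N$, $z\in\mathbb{C}$, where row $j$ is $M_{jj'}=(\frac{\mathrm{i}z}{4\pi}-\beta_j)\delta_{jj'}+\widetilde G_z(y_j-y_{j'})$ if $a_j\neq\infty$, and $M_{jj'}=(1+\frac{\mathrm{i}z\beta_j}{4\pi})\delta_{jj'}+\beta_j\widetilde G_z(y_j-y_{j'})$ if $a_j=\infty$. The point $b\in\mathbb{C}^N$ is given by $b_j=a_j$ if $a_j\neq\infty$ and $b_j=0$ if $a_j=\infty$. *)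

(* Defs.v *)
From HB Require Import structures.
From mathcomp Require Import all_boot all_order all_algebra.
From mathcomp Require Import all_classical all_reals all_analysis.
From mathcomp Require Export complex.

Set Implicit Arguments.
Unset Strict Implicit.
Unset Printing Implicit Defensive.

Import Order.TTheory GRing.Theory Num.Theory.
Import numFieldNormedType.Exports.

Local Open Scope classical_set_scope.
Local Open Scope ring_scope.
Local Open Scope complex_scope.

(* [None] stands for the point at infinity: [option R[i]] is the extended
   complex plane and [option R] the extended real line R U {oo}. *)
Notation ext T := (option T).

Definition cexp (R : realType) (z : R[i]) : R[i] :=
  (expR (complex.Re z))%:C *
  (cos (complex.Im z) +i* sin (complex.Im z)).

(* The library norm on ['rV_3] is the sup norm. *)
Definition eucl_norm (R : realType) (x : 'rV[R]_3) : R :=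
  Num.sqrt (\sum_(i < 3) x ord0 i ^+ 2).

Definition Green (R : realType) (z : R[i]) (x : 'rV[R]_3) : R[i] :=
  cexp ('i%C * z * (eucl_norm x)%:C) / (4 * pi * eucl_norm x)%:C.

Definition Green0 (R : realType) (z : R[i]) (x : 'rV[R]_3) : R[i] :=
  if x == 0 then 0 else Green z x.

Definition diag_term (R : realType) (z : R[i]) : R[i] :=
  'i%C * z / (4 * pi)%:C.

Definition Gamma (R : realType) (n : nat) (alpha : 'I_n -> R[i])
    (Y : 'I_n -> 'rV[R]_3) (z : R[i]) : 'M[R[i]]_n :=
  \matrix_(j, j') ((alpha j - diag_term z) *+ (j == j')
                   - Green0 z (Y j - Y j')).

Definition finite_idx (T : eqType) (N : nat) (a : 'I_N -> ext T) : pred 'I_N :=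
  [pred j | a j != None].

(* The centres with infinite parameter are deleted; [enum_val] lists the
   remaining indices in increasing order. The default value of [odflt] is
   never used. *)
Definition det_Gamma (R : realType) (N : nat) (alpha : 'I_N -> ext R[i])
    (Y : 'I_N -> 'rV[R]_3) (z : R[i]) : R[i] :=
  let idx (i : 'I_#|finite_idx alpha|) : 'I_N := enum_val i in
  \det (Gamma (fun i => odflt 0 (alpha (idx i))) (fun i => Y (idx i)) z).

Definition Sigma (R : realType) (N : nat) (alpha : 'I_N -> ext R[i])
    (Y : 'I_N -> 'rV[R]_3) : set R[i] :=
  [set z | det_Gamma alpha Y z = 0].

Definition Sigma_res (R : realType) (N : nat) (alpha : 'I_N -> ext R[i])
    (Y : 'I_N -> 'rV[R]_3) : set R[i] :=
  Sigma alpha Y `&`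
  ([set z | complex.Im z < 0] `|` [set z | complex.Im z = 0]).

Definition ext_real_complex (R : realType) (N : nat) (a : 'I_N -> ext R) :
    'I_N -> ext R[i] :=
  fun j => omap (fun x : R => x%:C) (a j).

(* The resonances of the family of all H_a with a in (R U {oo})^N. *)
Definition Sigma_res_real (R : realType) (N : nat) (Y : 'I_N -> 'rV[R]_3) :
    set R[i] :=
  \bigcup_(a in [set: 'I_N -> ext R]) Sigma_res (ext_real_complex a) Y.

Definition achievable_frequency (R : realType) (N : nat)
    (Y : 'I_N -> 'rV[R]_3) (f : R) : Prop :=
  exists2 k, Sigma_res_real Y k & f = complex.Re k.

Definition r_min (R : realType) (N : nat) (Y : 'I_N -> 'rV[R]_3) (f : R) : R :=
  inf [set r : R | 0 <= r /\ Sigma_res_real Y (f -i* r)].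

Definition minimal_decay (R : realType) (N : nat) (Y : 'I_N -> 'rV[R]_3)
    (f : R) (k : R[i]) (a : 'I_N -> ext R) : Prop :=
  [/\ achievable_frequency Y f,
      k = f -i* r_min Y f &
      Sigma_res (ext_real_complex a) Y k].

Definition reg_det (R : realType) (N : nat) (a : 'I_N -> ext R[i])
    (Y : 'I_N -> 'rV[R]_3) (beta : 'I_N -> R[i]) (z : R[i]) : R[i] :=
  (-1) ^+ #|finite_idx a| *
  \det (\matrix_(j < N, j' < N)
    if a j != None then
      (diag_term z - beta j) *+ (j == j') + Green0 z (Y j - Y j')
    else
      (1 + diag_term z * beta j) *+ (j == j')
      + beta j * Green0 z (Y j - Y j')).

Definition base_point (R : realType) (N : nat) (a : 'I_N -> ext R[i]) :
    'I_N -> R[i] :=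
  fun j => odflt 0 (a j).

(* Partial derivative in the complex variable [beta j]. *)
Definition cpartial (R : realType) (N : nat) (F : ('I_N -> R[i]) -> R[i])
    (j : 'I_N) (beta : 'I_N -> R[i]) : R[i] :=
  derive1 (fun t : R[i] => F [eta beta with j |-> t] : R[i]^o) (beta j).

(* Boundary in the complex plane; [R[i]^o] carries the topology of the norm
   of [R[i]]. *)
Definition bd (R : realType) (A : set R[i]) : set R[i] :=
  closure (A : set R[i]^o) `\` interior (A : set R[i]^o).

Definition ray (R : realType) (xi : R) : set R[i] :=
  [set w | exists2 t : R, 0 <= t & w = cexp ('i%C * xi%:C) * t%:C].

Definition line (R : realType) (xi : R) : set R[i] :=
  [set w | exists t : R, w = cexp ('i%C * xi%:C) * t%:C].

(* Main.v *)
Require Import Defs.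
From mathcomp Require Import all_boot all_order all_algebra.
From mathcomp Require Import all_classical all_reals all_analysis.
From mathcomp Require Import ring lra.
Import Order.TTheory GRing.Theory Num.Theory.
Import numFieldNormedType.Exports.
Local Open Scope classical_set_scope.
Local Open Scope ring_scope.
Local Open Scope complex_scope.

Set Implicit Arguments.
Unset Strict Implicit.
Unset Printing Implicit Defensive.

(** Why the theorem holds.

    Put T(z) = (iz / 4 pi) I + (Green0 z (y_j - y_l)), a complex symmetric
    matrix, and let the pencil with parameters lam, mu be the matrix with rows
    lam_j e_j + mu_j T_j.  Up to a sign the regularized determinant is the
    determinant of the pencil with (lam_j, mu_j) = (- beta_j, 1) where a_j is
    finite and (1, beta_j) where it is infinite, and z is a resonance of a real
    Hamiltonian iff Im z <= 0 and the pencil is singular for some pairs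
    (lam_j, mu_j) of real numbers, none of them (0, 0).  The value
    alpha_j = oo is the pair (1, 0) and needs no separate treatment.

    Real k.  The matrix (sign k) Im T(k) is the kernel sin(|k| r) / (4 pi r),
    which is positive semidefinite on R^3: it is the average of plane waves
    over the sphere.  Hence a kernel vector of a real singular pencil is
    annihilated by Im T(k), the kernel is spanned by a real vector, and the
    symmetry of T turns the cofactors into multiples of the squares of the
    coordinates of that vector: all the derivatives lie on one ray
    ([real_pencil_ray]).

    Im k < 0, part (ii).  When two parameters vary, the determinant is
    A + B s + C t + E s t, where A vanishes at k and B, C are the two partial
    derivatives.  If B and C are not real multiples of each other at k, then
    for every z near k the equation s = - (A + C t) / (B + E t) can be solved in
    real s, t: the imaginary part of the right-hand side changes sign with t
    ([bilinear_real_zero]).  So k is interior to the set of resonances.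

    Im k < 0, part (i).  If the derivatives are not on a common ray, the same
    equation is solvable near k with s and t in a prescribed closed half-plane
    ([bilinear_half_plane_zero]), that is, with dissipative parameters; in
    particular at f - i r' with r' < r.  Dissipation cannot help:
    [dissipative_to_real] makes the parameters real one after another while r'
    only decreases.  With the other parameters fixed, the parameter that makes
    the pencil singular at f - i t moves continuously on the Riemann sphere with
    t; it cannot be strictly dissipative at t = 0, where Im T is semidefinite,
    so it crosses the extended real line in between.  This contradicts the
    minimality of r.

    Semidefiniteness of the sinc kernel ([sinc_kernel_ge0]) is obtained from
    moments.  The average of (w . x)^(2m) over the unit sphere is
    |x|^(2m) / (2m+1), so termwise averaging of the Taylor polynomials of cos
    gives those of sin r / r, and cos is a positive semidefinite kernel on the
    line.  The average over each circle of latitude is taken over the n-th roots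
    of unity, which is exact in degrees below n, and the average over the
    latitudes is that of a polynomial over [-1, 1]; no integral on the sphere is
    involved. *)

(** * Averages of powers over the roots of unity *)

Definition cis (R : realType) (t : R) : R[i] := cos t +i* sin t.

Lemma cisD (R : realType) (s t : R) : cis (s + t) = cis s * cis t.
Proof. by rewrite /cis cosD sinD; simpc; rewrite [sin s * _ + _]addrC. Qed.

Lemma cisMn (R : realType) (t : R) n : cis (t *+ n) = cis t ^+ n.
Proof.
elim: n => [|n IH]; first by rewrite mulr0n expr0 /cis cos0 sin0.
by rewrite mulrS exprS cisD IH.
Qed.

Lemma cis_conj (R : realType) (t : R) : cis t * (cis t)^* = 1.
Proof.
by rewrite /cis; simpc; rewrite -!expr2 cos2Dsin2 [cos t * _]mulrC addNr.
Qed.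

Lemma sum_root1_pow (F : fieldType) (z : F) n :
  z ^+ n = 1 -> z != 1 -> \sum_(j < n) z ^+ j = 0.
Proof.
move=> zn z1; have := subrX1 z n; rewrite zn subrr => /esym/eqP.
by rewrite mulf_eq0 subr_eq0 (negbTE z1) => /eqP.
Qed.

Lemma cis_neq1 (R : realType) (n d : nat) :
  (0 < d < n)%N -> cis (2 * pi / n%:R : R) ^+ d != 1.
Proof.
move=> /andP[d0 dn]; rewrite -cisMn.
have n0 : 0 < n%:R :> R by rewrite ltr0n (leq_trans d0 (ltnW dn)).
have -> : 2 * pi / n%:R *+ d = (pi * d%:R / n%:R) *+ 2 :> R.
  by rewrite -[LHS]mulr_natr -[RHS]mulr_natr; ring.
set x := pi * d%:R / n%:R.
have sx : 0 < sin x.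
  have d0' : 0 < d%:R :> R by rewrite ltr0n.
  apply: sin_gt0_pi; rewrite /x divr_gt0 ?mulr_gt0 ?pi_gt0 //=.
  by rewrite ltr_pdivrMr // ltr_pM2l ?pi_gt0 // ltr_nat.
apply/eqP => /(congr1 (@complex.Re R)) /=.
rewrite mulr2n cosD -!expr2 cos2sin2 => h.
have : 0 < sin x ^+ 2 by rewrite exprn_gt0.
by move: h; rewrite /=; lra.
Qed.

(** Expanding the power, the terms carry [z ^+ j] to exponents of absolute value
    at most [p < n], so that only the middle exponent, zero, survives the sum
    over the [n]-th roots of unity. *)
Lemma sum_cis_pow (R : realType) (w : R[i]) (n p : nat) : (p < n)%N ->
  let z := cis (2 * pi / n%:R : R) in
  \sum_(j < n) (w * (z ^+ j)^* + w^* * z ^+ j) ^+ p =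
  if odd p then 0 else (n * 'C(p, p./2))%:R * (w * w^*) ^+ p./2.
Proof.
move=> pn z.
have zz : z * z^* = 1 by exact: cis_conj.
have zn : z ^+ n = 1.
  have n0 : n%:R != 0 :> R by rewrite pnatr_eq0; case: n pn {z zz}.
  rewrite -cisMn -[_ *+ n]mulr_natr divfK // mulr_natl mulr2n cisD.
  by apply/eqP; rewrite /cis cospi sinpi eq_complex /=; apply/andP; split; apply/eqP; ring.
have zd d : (0 < d < n)%N -> \sum_(j < n) (z ^+ d) ^+ j = 0.
  move=> dn; apply: sum_root1_pow; first by rewrite exprAC zn expr1n.
  exact: cis_neq1.
have zcd d : (0 < d < n)%N -> \sum_(j < n) (z^* ^+ d) ^+ j = 0.
  move=> dn; have /(congr1 (@conjc R)) := zd d dn.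
  rewrite conjc0 rmorph_sum /= => h0; rewrite -[RHS]h0.
  by apply: eq_bigr => j _; rewrite !rmorphXn.
under eq_bigr do rewrite exprDn.
rewrite exchange_big /=.
have term (c : nat) (cp : (c <= p)%N) :
    \sum_(j < n) (w * (z ^+ j)^*) ^+ (p - c) * (w^* * z ^+ j) ^+ c *+ 'C(p, c) =
    if (c + c == p)%N then n%:R * (w * w^*) ^+ c *+ 'C(p, c) else 0.
  have -> : \sum_(j < n) (w * (z ^+ j)^*) ^+ (p - c) * (w^* * z ^+ j) ^+ c *+ 'C(p, c)
    = (w ^+ (p - c) * w^* ^+ c *+ 'C(p, c)) *
      \sum_(j < n) (z^* ^+ (p - c) * z ^+ c) ^+ j.
    rewrite mulr_sumr; apply: eq_bigr => j _.
    rewrite !exprMn mulrnAl; congr (_ *+ _).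
    rewrite rmorphXn /= -!exprM [(j * _)%N]mulnC [(j * c)%N]mulnC !exprM; ring.
  case: ifP => [/eqP cc|cc].
    have -> : (p - c = c)%N by rewrite -{1}cc addnK.
    rewrite (eq_bigr (fun=> 1)) => [|j _]; last first.
      by rewrite -exprMn [z^* * z]mulrC zz !expr1n.
    by rewrite sumr_const card_ord exprMn mulrnAl mulrC mulr_natl.
  (* The total exponent of z is 2 c - p; both signs occur. *)
  case: (ltnP (c + c) p) => h.
    have e : z^* ^+ (p - c) * z ^+ c = z^* ^+ (p - c - c).
      have h2 : (c <= p - c)%N by rewrite leq_subRL // ltnW.
      by rewrite -{1}(subnK h2) exprD -mulrA -exprMn [z^* * z]mulrC zz expr1n mulr1.
    rewrite e zcd ?mulr0 // -subnDA subn_gt0 h /=.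
    exact: leq_ltn_trans (leq_subr _ _) pn.
  have e : z^* ^+ (p - c) * z ^+ c = z ^+ (c - (p - c)).
    have -> : z ^+ c = z ^+ (p - c) * z ^+ (c - (p - c)).
      by rewrite -exprD subnKC // leq_subLR.
    by rewrite mulrA -exprMn [z^* * z]mulrC zz expr1n mul1r.
  have h' : (p < c + c)%N by rewrite ltn_neqAle h andbT eq_sym cc.
  rewrite e zd ?mulr0 // subn_gt0 ltn_subLR // h' /=.
  exact: leq_ltn_trans (leq_subr _ _) (leq_ltn_trans cp pn).
under eq_bigr => c _ do rewrite (term c (leq_ord c)).
case: ifP => op.
  rewrite big1 // => c _; case: eqP => // e.
  by have := odd_double c; rewrite -addnn e op.
have ep : (p./2 + p./2 = p)%N by rewrite addnn even_halfK // op.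
have hp : (p./2 < p.+1)%N by rewrite ltnS -{2}ep leq_addr.
rewrite (bigD1 (Ordinal hp)) //= ep eqxx big1 ?addr0 => [|c cn].
  by rewrite natrM -[in LHS]mulr_natr; ring.
case: eqP => // e; case/eqP: cn; apply: val_inj => /=.
by rewrite -[in RHS]e addnn doubleK.
Qed.

(** With [w = y1 + i y2], the real part of [w] times a conjugate root of unity is
    [y1 cos + y2 sin]. *)
Lemma sum_cos_sin_pow (R : realType) (y1 y2 : R) (n p : nat) : (p < n)%N ->
  let t := 2 * pi / n%:R : R in
  \sum_(j < n) (y1 * cos (t *+ j) + y2 * sin (t *+ j)) ^+ p =
  if odd p then 0
  else n%:R * ('C(p, p./2)%:R / 2 ^+ p * (y1 ^+ 2 + y2 ^+ 2) ^+ p./2).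
Proof.
move=> pn t; pose w : R[i] := y1 +i* y2.
have two0 : (2 : R) ^+ p != 0 by rewrite expf_neq0.
have h := sum_cis_pow w pn.
have e (j : nat) : w * (cis t ^+ j)^* + w^* * cis t ^+ j =
    (2 * (y1 * cos (t *+ j) + y2 * sin (t *+ j)))%:C.
  by rewrite -cisMn /cis /w; apply/eqP; rewrite eq_complex /=; apply/andP; split;
    apply/eqP; ring.
have ww : w * w^* = (y1 ^+ 2 + y2 ^+ 2)%:C.
  by rewrite /w; apply/eqP; rewrite eq_complex /=; apply/andP; split;
    apply/eqP; ring.
have h2 : (\sum_(j < n) (2 * (y1 * cos (t *+ j) + y2 * sin (t *+ j))) ^+ p)%:C =
    (if odd p then 0 else (n * 'C(p, p./2))%:R * (y1 ^+ 2 + y2 ^+ 2) ^+ p./2)%:C.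
  transitivity (\sum_(j < n) (w * (cis t ^+ j)^* + w^* * cis t ^+ j) ^+ p).
    rewrite rmorph_sum /=; apply: eq_bigr => j _; by rewrite e -rmorphXn.
  rewrite h; case: ifP => _ //.
  by rewrite ww -rmorphXn -(rmorph_nat (real_complex R)) -rmorphM.
have /complexI {}h2 := h2.
apply: (mulfI two0); rewrite mulr_sumr.
under eq_bigr do rewrite -exprMn.
rewrite h2; case: ifP => _; first by rewrite mulr0.
by rewrite natrM; field.
Qed.

(** * Averages of powers over the sphere *)
Lemma sum_even_terms (R : nmodType) (F : nat -> R) m :
  (forall i, odd i -> F i = 0) ->
  \sum_(i < m.*2.+1) F i = \sum_(b < m.+1) F b.*2.
Proof.
move=> F0; elim: m => [|m IH]; first by rewrite !big_ord1.
by rewrite doubleS 2!big_ord_recr IH [RHS]big_ord_recr /= F0 ?addr0 //= odd_double.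
Qed.

(** The average of [(omega . x) ^+ 2m] over the circle of latitude [u] of the unit
    sphere, as a polynomial in [u]; [x] has coordinate [x0] along the axis and
    squared distance [rho] to it. *)
Definition latitude_mean (R : realType) (m : nat) (x0 rho : R) : {poly R} :=
  \sum_(b < m.+1) ('C(m.*2, b.*2)%:R * 'C(b.*2, b)%:R / 4 ^+ b *
     x0 ^+ (m - b).*2 * rho ^+ b) *: ('X^((m - b).*2) * (1 - 'X^2) ^+ b).

(** A point of latitude [u] is [(u, s cos, s sin)] with [s ^+ 2 = 1 - u ^+ 2]. *)
Lemma latitude_meanP (R : realType) (m n : nat) (x0 y1 y2 u s : R) :
  (m.*2 < n)%N -> s ^+ 2 = 1 - u ^+ 2 ->
  let t := 2 * pi / n%:R : R in
  \sum_(j < n) (u * x0 + s * (y1 * cos (t *+ j) + y2 * sin (t *+ j))) ^+ m.*2 =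
  n%:R * (latitude_mean m x0 (y1 ^+ 2 + y2 ^+ 2)).[u].
Proof.
move=> mn su t.
under eq_bigr do rewrite exprDn.
rewrite exchange_big /=.
pose F i := \sum_(j < n) ((u * x0) ^+ (m.*2 - i) *
   (s * (y1 * cos (t *+ j) + y2 * sin (t *+ j))) ^+ i *+ 'C(m.*2, i)).
pose G i := ((u * x0) ^+ (m.*2 - i) * s ^+ i *+ 'C(m.*2, i)) * (if odd i then 0
  else n%:R * ('C(i, i./2)%:R / 2 ^+ i * (y1 ^+ 2 + y2 ^+ 2) ^+ i./2)).
have FG (i : 'I_m.*2.+1) : F i = G i.
  rewrite /F /G -sum_cos_sin_pow; last exact: leq_ltn_trans (leq_ord i) mn.
  rewrite mulr_sumr; apply: eq_bigr => j _.
  by rewrite mulrnAl [(s * _) ^+ i]exprMn mulrA.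
rewrite (eq_bigr (fun i : 'I__ => G i)) => [|i _]; last exact: FG.
rewrite (@sum_even_terms _ G) => [|i oi]; last by rewrite /G oi mulr0.
rewrite horner_sum mulr_sumr; apply: eq_bigr => b _.
have s2 : s ^+ b.*2 = (1 - u ^+ 2) ^+ b by rewrite -mul2n exprM su.
have t2 : (2 : R) ^+ b.*2 = 4 ^+ b.
  by rewrite -mul2n exprM; congr (_ ^+ _); ring.
have f0 : (4 : R) ^+ b != 0 by rewrite expf_neq0.
have hu : ((1 - 'X^2 : {poly R}) ^+ b).[u] = (1 - u ^+ 2) ^+ b.
  by rewrite horner_exp !hornerE.
rewrite /G odd_double doubleK hornerZ hornerM hornerXn hu s2 t2 -doubleB exprMn.
rewrite -[_ *+ 'C(m.*2, b.*2)]mulr_natr.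
move: f0.
move: ('C(m.*2, b.*2)%:R) ('C(b.*2, b)%:R) (4 ^+ b) (u ^+ (_).*2) (x0 ^+ _)
  ((1 - u ^+ 2) ^+ b) => c1 c2 c3 c4 c5 c6 c30.
by field.
Qed.

Definition poly_primitive (R : realType) (p : {poly R}) : {poly R} :=
  \poly_(i < (size p).+1) (p`_i.-1 / i%:R).

Lemma coef_primitive (R : realType) (p : {poly R}) i :
  (poly_primitive p)`_i = p`_i.-1 / i%:R.
Proof.
rewrite coef_poly; case: ltnP => // h.
by rewrite nth_default ?mul0r //; case: i h.
Qed.

Lemma deriv_primitive (R : realType) (p : {poly R}) : (poly_primitive p)^`() = p.
Proof.
apply/polyP => i; rewrite coef_deriv coef_primitive /= -[LHS]mulr_natr divfK // pnatr_eq0.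
Qed.

Lemma primitive_deriv (R : realType) (p : {poly R}) :
  poly_primitive p^`() = p - (p`_0)%:P.
Proof.
apply/polyP => -[|i]; rewrite coef_primitive coefB coefC coef_deriv /=.
  by rewrite invr0 mulr0 subrr.
by rewrite subr0 -[X in X / _]mulr_natr mulfK // pnatr_eq0.
Qed.

Lemma primitiveD (R : realType) (p q : {poly R}) :
  poly_primitive (p + q) = poly_primitive p + poly_primitive q.
Proof. by apply/polyP => i; rewrite coefD !coef_primitive coefD mulrDl. Qed.

Lemma primitiveZ (R : realType) (c : R) (p : {poly R}) :
  poly_primitive (c *: p) = c *: poly_primitive p.
Proof. by apply/polyP => i; rewrite coefZ !coef_primitive coefZ mulrA. Qed.

(** The average over the interval [-1, 1]. *)
Definition mean_int (R : realType) (p : {poly R}) : R :=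
  ((poly_primitive p).[1] - (poly_primitive p).[-1]) / 2.

Lemma mean_intD (R : realType) (p q : {poly R}) :
  mean_int (p + q) = mean_int p + mean_int q.
Proof. by rewrite /mean_int primitiveD !hornerD; field. Qed.

Lemma mean_intZ (R : realType) (c : R) (p : {poly R}) :
  mean_int (c *: p) = c * mean_int p.
Proof. by rewrite /mean_int primitiveZ !hornerZ; field. Qed.

Lemma mean_int_sum (R : realType) (I : finType) (F : I -> {poly R}) :
  mean_int (\sum_i F i) = \sum_i mean_int (F i).
Proof.
apply: (big_morph _ (@mean_intD R)).
by rewrite -(scale0r 0) mean_intZ mul0r.
Qed.

Lemma mean_int_deriv (R : realType) (p : {poly R}) :
  mean_int p^`() = (p.[1] - p.[-1]) / 2.
Proof. by rewrite /mean_int primitive_deriv !hornerE; field. Qed.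

Lemma mean_int_ge (R : realType) (p : {poly R}) (c : R) :
  (forall u, -1 <= u <= 1 -> c <= p.[u]) -> c <= mean_int p.
Proof.
move=> h; set q := poly_primitive p.
have [x xI e] : exists2 x, x \in `](-1 : R), 1[ & q.[1] - q.[-1] = (q^`()).[x] * (1 - (-1)).
  have := @MVT R (horner q) (horner q^`()) (-1) 1; apply; first lra.
  by apply: continuous_subspaceT => x; apply: continuous_horner.
rewrite /mean_int -/q e /q deriv_primitive.
have : c <= p.[x].
  by apply: h; move: xI; rewrite in_itv /= => /andP[a b]; rewrite !ltW.
lra.
Qed.

(** Integration by parts: the derivative of [X^(2a+1) (1 - X^2)^(b+1)] has mean
    zero, because this polynomial vanishes at both ends. *)
Lemma mean_int_beta_rec (R : realType) (a b : nat) :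
  a.*2.+1%:R * mean_int ('X^(a.*2) * (1 - 'X^2) ^+ b.+1 : {poly R}) =
  b.+1.*2%:R * mean_int ('X^(a.+1.*2) * (1 - 'X^2) ^+ b : {poly R}).
Proof.
have := mean_int_deriv ('X^(a.*2.+1) * (1 - 'X^2) ^+ b.+1 : {poly R}).
have -> : ('X^(a.*2.+1) * (1 - 'X^2) ^+ b.+1 : {poly R})^`() =
   a.*2.+1%:R *: ('X^(a.*2) * (1 - 'X^2) ^+ b.+1) +
   (- b.+1.*2%:R) *: ('X^(a.+1.*2) * (1 - 'X^2) ^+ b).
  rewrite derivM derivXn deriv_exp derivB derivXn derivC /= scaleNr !scaler_nat.
  rewrite sub0r mulNr mulNrn mulrN !mulrnAl !mulrnAr; congr (_ - _).
  by rewrite -mulrnA mul2n mulrA -exprD addn1 -doubleS.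
have root1 (e : R) : e ^+ 2 = 1 ->
    ('X^(a.*2.+1) * (1 - 'X^2) ^+ b.+1 : {poly R}).[e] = 0.
  by move=> e2; rewrite hornerM horner_exp !hornerE e2 subrr expr0n mulr0.
rewrite mean_intD !mean_intZ !root1 ?sqrrN ?expr1n // subrr mul0r mulNr.
by move/eqP; rewrite subr_eq0 => /eqP.
Qed.

Lemma mean_intXn (R : realType) (m : nat) :
  mean_int ('X^(m.*2) : {poly R}) = m.*2.+1%:R^-1.
Proof.
have n0 : m.*2.+1%:R != 0 :> R by rewrite pnatr_eq0.
apply: (mulfI n0); rewrite divff // -mean_intZ.
have -> : m.*2.+1%:R *: 'X^(m.*2) = ('X^(m.*2.+1))^`() :> {poly R}.
  by rewrite derivXn scaler_nat.
by rewrite mean_int_deriv !hornerXn expr1n -signr_odd /= odd_double expr1; field.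
Qed.

Lemma trinomial_fact (m b : nat) : (b <= m)%N ->
  ('C(m.*2, b.*2) * 'C(b.*2, b) * (m - b).*2`! * (b`! * b`!) = m.*2`!)%N.
Proof.
move=> bm; have h : (b.*2 <= m.*2)%N by rewrite leq_double.
have hb : (b <= b.*2)%N by rewrite -addnn leq_addr.
have e : (b.*2 - b = b)%N by rewrite -addnn addnK.
rewrite -(bin_fact h) -doubleB -(bin_fact hb) e.
by rewrite -!mulnA; congr (_ * (_ * _))%N; rewrite mulnC -mulnA.
Qed.

Lemma trinomial_rec (R : realType) (m b : nat) : (b < m)%N ->
  ('C(m.*2, b.+1.*2)%:R * 'C(b.+1.*2, b.+1)%:R * b.+1%:R ^+ 2 =
  'C(m.*2, b.*2)%:R * 'C(b.*2, b)%:R * ((m - b.+1).*2.+2%:R * (m - b.+1).*2.+1%:R)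
   :> R).
Proof.
move=> bm; have := trinomial_fact bm; rewrite -(trinomial_fact (ltnW bm)).
have -> : ((m - b).*2 = (m - b.+1).*2.+2)%N by rewrite -doubleS -subSn.
set a := (m - b.+1)%N => /(congr1 (fun n => n%:R : R)).
rewrite !factS !natrM => h.
have f1 : (a.*2)`!%:R != 0 :> R by rewrite pnatr_eq0 -lt0n fact_gt0.
have f2 : b`!%:R != 0 :> R by rewrite pnatr_eq0 -lt0n fact_gt0.
apply: (mulIf f1); apply: (mulIf f2); apply: (mulIf f2).
by move: h f1 f2 => + _ _; move: ('C(_, _)%:R) => c1; lra.
Qed.

(** The beta integral, normalized so that the averages over the circles of
    latitude add up to the binomial expansion of a power of [x0 ^+ 2 + rho]. *)
Lemma mean_int_beta (R : realType) (m b : nat) : (b <= m)%N ->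
  'C(m.*2, b.*2)%:R * 'C(b.*2, b)%:R / 4 ^+ b *
     mean_int ('X^((m - b).*2) * (1 - 'X^2) ^+ b : {poly R}) =
  'C(m, b)%:R / m.*2.+1%:R.
Proof.
elim: b => [|b IH] bm.
  by rewrite subn0 !bin0 !expr0 [X in mean_int X]mulr1 mean_intXn divr1 !mul1r.
have {}IH := IH (ltnW bm).
have tr := trinomial_rec R bm.
have br := mean_int_beta_rec R (m - b.+1) b.
have pr : b.+1%:R * 'C(m, b.+1)%:R = (m - b.+1).+1%:R * 'C(m, b)%:R :> R.
  by rewrite -!natrM mul_bin_left -subSn.
have b0 : b.+1%:R ^+ 2 != 0 :> R by rewrite expf_neq0 // pnatr_eq0.
have f0 : (4 : R) ^+ b != 0 by rewrite expf_neq0.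
have m0 : m.*2.+1%:R != 0 :> R by rewrite pnatr_eq0.
have em : (m - b = (m - b.+1).+1)%N by rewrite -subSn.
rewrite em in IH; move: tr br pr IH b0; set a := (m - b.+1)%N.
have d1 : a.*2.+2%:R = 2 * a.+1%:R :> R by rewrite -natrM mul2n doubleS.
have d2 : b.+1.*2%:R = 2 * b.+1%:R :> R by rewrite -natrM mul2n.
rewrite d1 d2 [4 ^+ b.+1]exprS.
move: (mean_int _) (mean_int _) ('C(m.*2, b.*2)%:R * 'C(b.*2, b)%:R)
  ('C(m.*2, b.+1.*2)%:R * 'C(b.+1.*2, b.+1)%:R) ('C(m, b)%:R) ('C(m, b.+1)%:R)
  => I I' c c' B B' tr br pr IH b0.
apply: (mulfI b0).
rewrite [LHS](_ : _ = (c' * b.+1%:R ^+ 2) * I' / (4 * 4 ^+ b)); last by field.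
rewrite tr [LHS](_ : _ =
  c * (2 * a.+1%:R) * (a.*2.+1%:R * I') / (4 * 4 ^+ b)); last by field.
rewrite br [LHS](_ : _ = a.+1%:R * b.+1%:R * (c / 4 ^+ b * I)); last by field.
rewrite IH [RHS](_ : _ = b.+1%:R * (b.+1%:R * B') / m.*2.+1%:R); last by field.
by rewrite pr; field.
Qed.

(** By Archimedes, uniform measure on the sphere is uniform in latitude, so this is
    the average of [(omega . x) ^+ 2m] over the sphere. *)
Lemma mean_int_latitude (R : realType) (m : nat) (x0 rho : R) :
  mean_int (latitude_mean m x0 rho) = (x0 ^+ 2 + rho) ^+ m / m.*2.+1%:R.
Proof.
rewrite mean_int_sum exprDn mulr_suml; apply: eq_bigr => b _.
rewrite mean_intZ -[_ *+ 'C(m, b)]mulr_natr -[RHS]mulrA.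
rewrite -mean_int_beta; last exact: leq_ord.
have -> : x0 ^+ (m - b).*2 = (x0 ^+ 2) ^+ (m - b) by rewrite -mul2n exprM.
have AC (k x r z : R) : k * x * r * z = x * r * (k * z) by ring.
exact: AC.
Qed.

(** * The sinc kernel is positive semidefinite on R^3 *)
Lemma cvg_sumr (K : numFieldType) (V : normedModType K) (T I : Type)
    (F : set_system T) (FF : Filter F) (r : seq I) (f : I -> T -> V) (a : I -> V) :
  (forall i, f i @ F --> a i) ->
  (fun x => \sum_(i <- r) f i x) @ F --> \sum_(i <- r) a i.
Proof. by move=> fa; apply: cvg_big => [|i _]; [exact: add_continuous|exact: fa]. Qed.

Definition cos_trunc (R : realType) (M : nat) (t : R) : R :=
  \sum_(m < M) (-1) ^+ m / m.*2`!%:R * t ^+ m.*2.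

Definition sinc_trunc (R : realType) (M : nat) (r2 : R) : R :=
  \sum_(m < M) (-1) ^+ m / m.*2.+1`!%:R * r2 ^+ m.

Definition sinc (R : realType) (r : R) : R := if r == 0 then 1 else sin r / r.

Lemma series_cos_coeff_double (R : realType) (t : R) M :
  series (cos_coeff t) M.*2 = cos_trunc M t.
Proof.
rewrite /cos_trunc /series /= big_mkord; elim: M => [|M IH].
  by rewrite !big_ord0.
rewrite doubleS !big_ord_recr /= IH cos_coeff_odd addr0; congr (_ + _).
by rewrite -cos_coeff'E /cos_coeff' mulrAC.
Qed.

(** The tail of the cosine series is dominated by that of the exponential series
    at [T]. *)
Lemma cos_trunc_uniform (R : realType) (T e : R) : 0 < e ->
  \forall M \near \oo, forall t, `|t| <= T -> `|cos t - cos_trunc M t| <= e.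
Proof.
move=> e0.
have [T0|T0] := ltP T 0.
  near=> M => t tT; have := le_lt_trans tT T0; by rewrite normr_lt0.
have cE : cvgn (series (exp_coeff T)) by exact: is_cvg_series_exp_coeff.
have tail n t : `|t| <= T ->
    `|cos t - series (cos_coeff t) n| <=
    limn (series (exp_coeff T)) - series (exp_coeff T) n.
  move=> tT.
  have cc : (fun k => `|series (cos_coeff t) k - series (cos_coeff t) n|) @ \oo
      --> `|cos t - series (cos_coeff t) n|.
    apply: cvg_norm; apply: cvgB; last exact: cvg_cst.
    by rewrite unlock; exact: is_cvg_series_cos_coeff.
  apply: (cvgr_to_le cc); exists n => // k /= nk.
  have mono : nondecreasing_seq (series (exp_coeff T)).
    by apply: nondecreasing_series => i _ _; exact: exp_coeff_ge0.
  apply: (@le_trans _ _ (series (exp_coeff T) k - series (exp_coeff T) n)); last first.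
    by rewrite lerD2r; exact: nondecreasing_cvgn_le.
  have := sub_series_geq (cos_coeff t) nk; rewrite /series /= => ->.
  have := sub_series_geq (exp_coeff T) nk; rewrite /series /= => ->.
  apply: le_trans (ler_norm_sum _ _ _) _; apply: ler_sum => i _.
  rewrite /exp_coeff /cos_coeff /= !normrM normrX normfV normrX normrN1 expr1n mulr1.
  rewrite !normr_nat ler_wpM2r ?invr_ge0 ?ler0n //.
  apply: le_trans (_ : `|t| ^+ i <= _); last by rewrite lerXn2r ?nnegrE.
  by rewrite ler_piMl ?exprn_ge0 //; case: odd.
have /cvgrPdist_le /(_ e e0) [n _ hn] := cE.
exists n => // M /= nM t tT.
rewrite -series_cos_coeff_double; apply: le_trans (tail _ _ tT) _.
apply: le_trans (hn M.*2 _); first exact: ler_norm.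
by rewrite /= (leq_trans nM) // -addnn leq_addr.
Unshelve. all: by end_near.
Qed.

Lemma cvg_sinc_trunc (R : realType) (r : R) :
  (fun M => sinc_trunc M (r ^+ 2)) @ \oo --> sinc r.
Proof.
rewrite /sinc; case: eqP => [->|/eqP r0].
  apply: cvg_near_cst; exists 1%N => // -[//|M] _.
  rewrite /sinc_trunc big_ord_recl big1 ?addr0 /= => [|i _].
    by rewrite !expr0 [(_`!)%N]/= invr1 !mulr1.
  by rewrite [0 ^+ 2]expr0n /= expr0n mulr0.
have -> : (fun M => sinc_trunc M (r ^+ 2)) = (fun M => series (sin_coeff' r) M / r).
  apply/funext => M; rewrite /sinc_trunc /series /= big_mkord mulr_suml.
  apply: eq_bigr => i _; rewrite /sin_coeff' -exprM mul2n exprS.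
  rewrite -[LHS](mulfK r0); congr (_ / _).
  by rewrite -exprnP; set f := (_`!%:R)^-1; ring.
by apply: cvgMl; exact: cvg_sin_coeff'.
Qed.

Lemma cos_kernel_ge0 (R : realType) (n : nat) (c a : 'I_n -> R) :
  0 <= \sum_j \sum_l c j * c l * cos (a j - a l).
Proof.
have -> : \sum_j \sum_l c j * c l * cos (a j - a l) =
    (\sum_j c j * cos (a j)) ^+ 2 + (\sum_j c j * sin (a j)) ^+ 2.
  rewrite !expr2 !mulr_suml -big_split; apply: eq_bigr => j _ /=.
  rewrite !mulr_sumr -big_split; apply: eq_bigr => l _ /=.
  by rewrite cosB; ring.
by rewrite addr_ge0 ?sqr_ge0.
Qed.

Lemma eucl_norm_sqr (R : realType) (x : 'rV[R]_3) :
  eucl_norm x ^+ 2 = x ord0 0 ^+ 2 + (x ord0 1 ^+ 2 + x ord0 2 ^+ 2).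
Proof.
rewrite /eucl_norm sqr_sqrtr; last by apply: sumr_ge0 => i _; exact: sqr_ge0.
rewrite !big_ord_recl big_ord0 addr0; congr (_ + (_ + _)).
  by congr (x _ _ ^+ 2); apply: val_inj.
by congr (x _ _ ^+ 2); apply: val_inj.
Qed.

(** The Taylor polynomials of the kernel are averages over the sphere of those of
    [cos (omega . (x j - x l))], which are within [e] of a semidefinite kernel as
    soon as the degree is large. *)
Lemma sinc_kernel_ge0 (R : realType) (n : nat) (c : 'I_n -> R)
    (x : 'I_n -> 'rV[R]_3) :
  0 <= \sum_j \sum_l c j * c l * sinc (eucl_norm (x j - x l)).
Proof.
pose d (i : 'I_3) j l : R := x j ord0 i - x l ord0 i.
have dE j l i : (x j - x l) ord0 i = d i j l by rewrite !mxE.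
pose T := \sum_j \sum_l (`|d 0 j l| + (`|d 1 j l| + `|d 2 j l|)).
pose K := \sum_j \sum_l `|c j * c l|.
have K0 : 0 <= K by apply: sumr_ge0 => j _; apply: sumr_ge0.
have dT j l : `|d 0 j l| + (`|d 1 j l| + `|d 2 j l|) <= T.
  have g0 j' l' : 0 <= `|d 0 j' l'| + (`|d 1 j' l'| + `|d 2 j' l'|).
    by rewrite !addr_ge0.
  rewrite /T (bigD1 j) //= (bigD1 l) //= -addrA lerDl addr_ge0 //.
    exact: sumr_ge0.
  by apply: sumr_ge0 => *; apply: sumr_ge0.
have cvS : (fun M => \sum_j \sum_l c j * c l * sinc_trunc M (eucl_norm (x j - x l) ^+ 2))
    @ \oo --> \sum_j \sum_l c j * c l * sinc (eucl_norm (x j - x l)).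
  apply: cvg_sumr => j; apply: cvg_sumr => l.
  by apply: cvgMr; exact: cvg_sinc_trunc.
suff lowbound e : 0 < e -> - (e * K) <=
    \sum_j \sum_l c j * c l * sinc (eucl_norm (x j - x l)).
  rewrite leNgt; apply/negP => S0.
  set S := \sum_j _ in S0 lowbound.
  have K1 : 0 < K + 1 by lra.
  have := lowbound (- S / (K + 1)); rewrite divr_gt0 ?oppr_gt0 // => /(_ isT).
  rewrite lerNl mulrAC lter_pdivlMr //.
  have : S * K <= 0 by rewrite mulr_le0_ge0 // ltW.
  nra.
move=> e0; apply: (cvgr_to_ge cvS).
apply: filterS (cos_trunc_uniform T e0) => M cosM.
(* The truncated quadratic form, averaged along the circle of latitude u. *)
pose Q : {poly R} := \sum_j \sum_l (c j * c l) *: \sum_(m < M)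
  ((-1) ^+ m / m.*2`!%:R) *: latitude_mean m (d 0 j l) (d 1 j l ^+ 2 + d 2 j l ^+ 2).
have <- : mean_int Q = \sum_j \sum_l c j * c l * sinc_trunc M (eucl_norm (x j - x l) ^+ 2).
  rewrite mean_int_sum; apply: eq_bigr => j _.
  rewrite mean_int_sum; apply: eq_bigr => l _.
  rewrite mean_intZ mean_int_sum; congr (_ * _); apply: eq_bigr => m _.
  rewrite mean_intZ mean_int_latitude eucl_norm_sqr !dE factS natrM invfM.
  by set f := _^-1; set g := _^-1; ring.
apply: mean_int_ge => u u1.
pose s := Num.sqrt (1 - u ^+ 2).
have u2 : 0 <= 1 - u ^+ 2 by nra.
have su : s ^+ 2 = 1 - u ^+ 2 by rewrite sqr_sqrtr.
(* Averages over N-th roots of unity are exact in degrees below N. *)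
pose N := M.*2.+1.
have N0 : 0 < N%:R :> R by rewrite ltr0n.
pose t := 2 * pi / N%:R : R.
pose a (i : 'I_N) j := u * x j ord0 0 +
  s * (x j ord0 1 * cos (t *+ i) + x j ord0 2 * sin (t *+ i)).
have Qu : N%:R * Q.[u] = \sum_(i < N) \sum_j \sum_l c j * c l * cos_trunc M (a i j - a i l).
  rewrite /Q horner_sum mulr_sumr exchange_big; apply: eq_bigr => j _ /=.
  rewrite horner_sum mulr_sumr exchange_big; apply: eq_bigr => l _ /=.
  rewrite hornerZ horner_sum -mulr_sumr mulrCA; congr (_ * _).
  rewrite mulr_sumr exchange_big; apply: eq_bigr => m _ /=.
  rewrite hornerZ -mulr_sumr mulrCA; congr (_ * _).
  rewrite -(@latitude_meanP _ _ _ _ _ _ _ s) //; last first.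
    by rewrite /N ltnS leq_double ltnW.
  by apply: eq_bigr => i _; congr (_ ^+ _); rewrite /a /d -/t; ring.
rewrite -(ler_pM2l N0) Qu mulr_natl -[X in _ *+ X]card_ord -sumr_const.
apply: ler_sum => i _.
have h : `|\sum_j \sum_l c j * c l * cos (a i j - a i l) -
    \sum_j \sum_l c j * c l * cos_trunc M (a i j - a i l)| <= e * K.
  rewrite -sumrB /K mulr_sumr; apply: le_trans (ler_norm_sum _ _ _) _.
  apply: ler_sum => j _.
  rewrite -sumrB mulr_sumr; apply: le_trans (ler_norm_sum _ _ _) _.
  apply: ler_sum => l _.
  rewrite -mulrBr normrM mulrC ler_wpM2r // cosM //.
  apply: le_trans (dT j l).
  have -> : a i j - a i l =
      u * d 0 j l + (s * cos (t *+ i) * d 1 j l + s * sin (t *+ i) * d 2 j l).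
    by rewrite /a /d; ring.
  have bd3 (p q : R) : `|p| <= 1 -> `|p * q| <= `|q|.
    by move=> p1; rewrite normrM ler_piMl.
  have su1 : `|s| <= 1.
    rewrite ger0_norm ?sqrtr_ge0 // -(@ler_pXn2r _ 2) ?nnegrE ?sqrtr_ge0 //.
    by rewrite expr1n su; have := sqr_ge0 u; lra.
  apply: le_trans (ler_normD _ _) _; apply: lerD.
    by apply: bd3; rewrite ler_norml.
  apply: le_trans (ler_normD _ _) _; apply: lerD; apply: bd3;
    rewrite normrM mulr_ile1 //.
    by rewrite ler_norml cos_geN1 cos_le1.
  by rewrite ler_norml sin_geN1 sin_le1.
have := cos_kernel_ge0 c (a i).
by move: h; rewrite ler_norml; lra.
Qed.

(** * Pencils: matrices whose rows combine a unit row and a row of T *)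
Lemma det_eq0P (F : fieldType) (n : nat) (M : 'M[F]_n) :
  \det M = 0 <->
  exists2 v : 'I_n -> F, (exists j, v j != 0) & forall j, \sum_l M j l * v l = 0.
Proof.
split=> [/eqP|[v [j vj] Mv]].
  rewrite -det_tr => /det0P [u u0 uM].
  have /rV0Pn [j uj] := u0; exists (u ord0); first by exists j.
  move=> i; have /matrixP /(_ ord0 i) := uM; rewrite !mxE => {2}<-.
  by apply: eq_bigr => l _; rewrite !mxE mulrC.
apply/eqP; rewrite -det_tr; apply/det0P; exists (\row_l v l).
  by apply/rV0Pn; exists j; rewrite mxE.
apply/matrixP => i l; rewrite !mxE -[RHS](Mv l).
by apply: eq_bigr => m _; rewrite !mxE mulrC.
Qed.

Definition pencil (F : comNzRingType) (n : nat) (T : 'M[F]_n)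
    (lam mu : 'I_n -> F) : 'M[F]_n :=
  \matrix_(j, l) (lam j *+ (j == l) + mu j * T j l).

Lemma pencil_mulE (F : comNzRingType) (n : nat) (T : 'M[F]_n)
    (lam mu v : 'I_n -> F) j :
  \sum_l pencil T lam mu j l * v l = lam j * v j + mu j * \sum_l T j l * v l.
Proof.
under eq_bigr do rewrite mxE mulrDl.
rewrite big_split /= (bigD1 j) //= eqxx big1 ?addr0 => [|l lj].
  by rewrite mulr_sumr; congr (_ + _); apply: eq_bigr => l _; rewrite mulrA.
by rewrite eq_sym (negbTE lj) mul0r.
Qed.

Lemma det_pencil_row (F : comNzRingType) (n : nat) (T : 'M[F]_n)
    (lam mu : 'I_n -> F) j (x y : F) :
  \det (pencil T [eta lam with j |-> x] [eta mu with j |-> y]) =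
  x * \det (pencil T [eta lam with j |-> 1] [eta mu with j |-> 0]) +
  y * \det (pencil T [eta lam with j |-> 0] [eta mu with j |-> 1]).
Proof.
apply: (determinant_multilinear (i0 := j)).
- by apply/rowP => l; rewrite !mxE /= eqxx; case: eqP => _; rewrite ?mulr1n ?mulr0n; ring.
- by apply/matrixP => a b; rewrite !mxE /= eq_sym (negbTE (neq_lift _ _)).
- by apply/matrixP => a b; rewrite !mxE /= eq_sym (negbTE (neq_lift _ _)).
Qed.

Lemma eq_pencil (F : comNzRingType) (n : nat) (T : 'M[F]_n)
    (lam mu lam' mu' : 'I_n -> F) :
  lam =1 lam' -> mu =1 mu' -> pencil T lam mu = pencil T lam' mu'.
Proof. by move=> e1 e2; apply/matrixP => a b; rewrite !mxE e1 e2. Qed.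

Lemma det_pencil_cofactor (F : comNzRingType) (n : nat) (T : 'M[F]_n)
    (lam mu : 'I_n -> F) j (x y : F) :
  \det (pencil T [eta lam with j |-> x] [eta mu with j |-> y]) =
  \sum_l (x *+ (j == l) + y * T j l) * cofactor (pencil T lam mu) j l.
Proof.
rewrite (expand_det_row _ j); apply: eq_bigr => l _; rewrite !mxE /= eqxx.
congr (_ * _); rewrite /cofactor; congr (_ * \det _).
by apply/matrixP => a b; rewrite !mxE /= eq_sym (negbTE (neq_lift _ _)).
Qed.

(** The cofactor is the determinant of [M] with row [j0] replaced by the unit row
    at [i0], and [v] is in the kernel of that matrix. *)
Lemma cofactor_kernel (F : fieldType) (n : nat) (M : 'M[F]_n) (i0 j0 : 'I_n)
    (v : 'I_n -> F) :
  cofactor M j0 i0 != 0 -> (forall j, \sum_l M j l * v l = 0) -> v i0 = 0 ->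
  forall l, v l = 0.
Proof.
move=> k0 Mv vi l; apply: contraNeq k0 => vl.
pose M' : 'M[F]_n := \matrix_(i, m) (if i == j0 then (m == i0)%:R else M i m).
have <- : \det M' = cofactor M j0 i0.
  rewrite (expand_det_row _ j0) (bigD1 i0) //= big1 ?addr0 => [|m mi].
    rewrite !mxE !eqxx mul1r /cofactor; congr (_ * \det _).
    by apply/matrixP => a b; rewrite !mxE eq_sym (negbTE (neq_lift _ _)).
  by rewrite !mxE eqxx (negbTE mi) mul0r.
apply/eqP/det_eq0P; exists v; first by exists l.
move=> j; under eq_bigr do rewrite mxE.
case: eqP => _ //; rewrite (bigD1 i0) //= vi mulr0 big1 ?addr0 // => m mi.
by rewrite (negbTE mi) mul0r.
Qed.

Lemma proportional_pair (F : fieldType) (lam mu v w : F) :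
  (lam != 0) || (mu != 0) -> lam * v + mu * w = 0 ->
  exists2 c, v = c * mu & w = - (c * lam).
Proof.
move=> /orP[l0|m0] e.
  exists (- w / lam); last by field.
  apply: (mulfI l0); have -> : lam * v = - (mu * w) by apply/eqP; rewrite -addr_eq0 e.
  by field.
exists (v / mu); first by field.
apply: (mulfI m0); have -> : mu * w = - (lam * v) by apply/eqP; rewrite -addr_eq0 addrC e.
by field.
Qed.

Lemma sum_delta (V : nmodType) (n : nat) (j : 'I_n) (f : 'I_n -> V) :
  \sum_l f l *+ (l == j) = f j.
Proof.
by rewrite (bigD1 j) //= eqxx mulr1n big1 ?addr0 // => l /negbTE ->.
Qed.

(** The form at [x + t e_j] is [t (2 b + t B_jj)] with [b] the [j]-th coordinate of
    [B x]; for small [t] it has the sign of [t b]. *)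
Lemma psd_form0_kernel (R : realType) (n : nat) (B : 'I_n -> 'I_n -> R)
    (x : 'I_n -> R) :
  (forall j l, B j l = B l j) ->
  (forall y : 'I_n -> R, 0 <= \sum_j \sum_l y j * y l * B j l) ->
  \sum_j \sum_l x j * x l * B j l = 0 ->
  forall j, \sum_l B j l * x l = 0.
Proof.
move=> Bs Bpsd Bx j.
set b := \sum_l _; apply: contrapT => /eqP b0.
pose y t i : R := x i + t *+ (i == j).
have yE t : \sum_i \sum_l y t i * y t l * B i l = t * (2 * b + t * B j j).
  have -> : \sum_i \sum_l y t i * y t l * B i l =
     \sum_i \sum_l x i * x l * B i l + t * b + t * \sum_i B j i * x i + t ^+ 2 * B j j.
    have e i : \sum_l y t i * y t l * B i l =
       \sum_l x i * x l * B i l + (t * \sum_l (B j l * x l)) *+ (i == j) + t * (B j i * x i)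
       + (t ^+ 2 * B j j) *+ (i == j).
      transitivity (\sum_l (x i * x l * B i l + (t * (B j l * x l)) *+ (i == j)) +
        \sum_l (t * x i * B i l + (t ^+ 2 * B j l) *+ (i == j)) *+ (l == j)).
        rewrite -big_split; apply: eq_bigr => l _ /=; rewrite /y.
        by case: (i =P j) => [->|_]; case: (l =P j) => [->|_]; rewrite ?mulr1n ?mulr0n; ring.
      rewrite big_split /=.
      rewrite [X in _ + X + _ = _](_ : _ = (t * \sum_l (B j l * x l)) *+ (i == j)); last first.
        by rewrite mulr_sumr -sumrMnl.
      rewrite sum_delta mulr_sumr -(Bs j i).
      by case: (i =P j) => [->|_]; rewrite ?mulr1n ?mulr0n; ring.
    under eq_bigr do rewrite e.
    rewrite !big_split /= -mulr_sumr.
    by rewrite !sum_delta.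
  by rewrite Bx -/b; ring.
have h t : 0 <= t * (2 * b + t * B j j) by rewrite -yE; exact: Bpsd.
have Bjj : 0 <= B j j.
  have := h 1; have := h (-1); rewrite !mul1r; lra.
(* A small negative multiple of b makes the form negative. *)
have := h (- b / (B j j + 1)).
have B1 : 0 < B j j + 1 by lra.
set c := _ / _.
have bc : b = - c * (B j j + 1) by rewrite /c; field; lra.
have c0 : c != 0 by apply: contraNneq b0 => c0; rewrite bc c0 oppr0 mul0r.
have : 0 < c ^+ 2 by rewrite exprn_even_gt0.
rewrite bc => c2.
have -> : c * (2 * (- c * (B j j + 1)) + c * B j j) = - (c ^+ 2 * (B j j + 2)) by ring.
rewrite oppr_ge0 pmulr_rle0 //; lra.
Qed.

(** * Kernels of dissipative and of real pencils *)
Lemma Im_sum (R : realType) (I : finType) (F : I -> R[i]) :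
  complex.Im (\sum_i F i) = \sum_i complex.Im (F i).
Proof. by apply: (big_morph (@complex.Im R)) => // -[? ?] [? ?]. Qed.

Lemma Re_sum (R : realType) (I : finType) (F : I -> R[i]) :
  complex.Re (\sum_i F i) = \sum_i complex.Re (F i).
Proof. by apply: (big_morph (@complex.Re R)) => // -[? ?] [? ?]. Qed.

Lemma Im_hermitian_form (R : realType) (n : nat) (T : 'M[R[i]]_n)
    (v : 'I_n -> R[i]) : (forall j l, T j l = T l j) ->
  \sum_j complex.Im ((v j)^* * \sum_l T j l * v l) =
  \sum_j \sum_l complex.Re (v j) * complex.Re (v l) * complex.Im (T j l) +
  \sum_j \sum_l complex.Im (v j) * complex.Im (v l) * complex.Im (T j l).
Proof.
move=> Ts.
pose a j := complex.Re (v j); pose b j := complex.Im (v j).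
pose A j l := complex.Re (T j l); pose B j l := complex.Im (T j l).
have -> : \sum_j complex.Im ((v j)^* * \sum_l T j l * v l) =
  \sum_j \sum_l ((a j * a l * B j l + b j * b l * B j l) +
                  (a j * b l * A j l - a l * b j * A l j)).
  apply: eq_bigr => j _; rewrite mulr_sumr Im_sum; apply: eq_bigr => l _.
  rewrite /a /b /A /B (Ts l j); case: (v j) (v l) (T j l) => [? ?] [? ?] [? ?] /=; ring.
under eq_bigr do rewrite big_split sumrB /=.
rewrite big_split sumrB /= [X in _ + (_ - X)]exchange_big subrr addr0.
by rewrite -big_split; apply: eq_bigr => j _; rewrite -big_split.
Qed.

(** For a kernel vector [v], [(v j, (T v) j) = c j * (mu j, - lam j)], so the
    imaginary part of [conj v . T v] is the sum of the dissipation terms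
    [- |c j|^2 Im (lam j conj (mu j))].  Semidefiniteness gives the other sign, hence
    every term vanishes. *)
Lemma dissipative_kernel (R : realType) (n : nat) (T : 'M[R[i]]_n) (s : R)
    (lam mu v : 'I_n -> R[i]) :
  s != 0 -> (forall j l, T j l = T l j) ->
  (forall y : 'I_n -> R, 0 <= \sum_j \sum_l y j * y l * (s * complex.Im (T j l))) ->
  (forall j, (lam j != 0) || (mu j != 0)) ->
  (forall j, 0 <= s * complex.Im (lam j * (mu j)^*)) ->
  (forall j, lam j * v j + mu j * \sum_l T j l * v l = 0) ->
  [/\ forall j, complex.Im (lam j * (mu j)^*) != 0 ->
        v j = 0 /\ \sum_l T j l * v l = 0,
      forall j, \sum_l complex.Im (T j l) * complex.Re (v l) = 0 &
      forall j, \sum_l complex.Im (T j l) * complex.Im (v l) = 0].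
Proof.
move=> s0 Ts Tpsd nz diss ker.
set w := fun j => \sum_l T j l * v l.
have [c vc] : exists c : 'I_n -> R[i], forall j, v j = c j * mu j /\ w j = - (c j * lam j).
  have e j : {c | v j = c * mu j /\ w j = - (c * lam j)}.
    apply: cid; have [c e1 e2] := proportional_pair (nz j) (ker j).
    by exists c.
  by exists (fun j => projT1 (e j)) => j; case: (e j).
pose p j := s * complex.Im ((v j)^* * w j).
have pE j : p j =
    - (complex.Re (c j) ^+ 2 + complex.Im (c j) ^+ 2) * (s * complex.Im (lam j * (mu j)^*)).
  rewrite /p; have [-> ->] := vc j.
  by case: (c j) (lam j) (mu j) => [? ?] [? ?] [? ?] /=; ring.
have p_le0 j : p j <= 0.
  by rewrite pE mulNr oppr_le0 mulr_ge0 // addr_ge0 ?sqr_ge0.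
pose q1 := \sum_j \sum_l complex.Re (v j) * complex.Re (v l) * (s * complex.Im (T j l)).
pose q2 := \sum_j \sum_l complex.Im (v j) * complex.Im (v l) * (s * complex.Im (T j l)).
have pq : \sum_j p j = q1 + q2.
  rewrite -mulr_sumr Im_hermitian_form // mulrDr !mulr_sumr; congr (_ + _);
    by apply: eq_bigr => j _; rewrite mulr_sumr; apply: eq_bigr => l _; rewrite mulrCA.
have q1p : 0 <= q1 by exact: Tpsd.
have q2p : 0 <= q2 by exact: Tpsd.
have p_sum : \sum_j - p j = 0.
  apply/eqP; rewrite eq_le; apply/andP; split; rewrite sumrN ?oppr_le0 ?oppr_ge0.
    by rewrite pq addr_ge0.
  by apply: sumr_le0.
have p0 j : p j = 0.
  have h (i : 'I_n) : true -> 0 <= - p i by rewrite oppr_ge0.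
  by have := psumr_eq0P h p_sum (i := j) isT; lra.
have [q10 q20] : q1 = 0 /\ q2 = 0.
  have : q1 + q2 = 0 by rewrite -pq big1.
  lra.
have ImTs j l : s * complex.Im (T j l) = s * complex.Im (T l j) by rewrite Ts.
have cancel_s (x : 'I_n -> R) :
    (forall j, \sum_l s * complex.Im (T j l) * x l = 0) ->
    forall j, \sum_l complex.Im (T j l) * x l = 0.
  move=> h j; apply: (mulfI s0); rewrite mulr0 -[RHS](h j) mulr_sumr.
  by apply: eq_bigr => l _; rewrite mulrA.
split.
- move=> j im0; have := p0 j; rewrite pE => /eqP.
  rewrite mulf_eq0 mulf_eq0 (negbTE s0) (negbTE im0) !orbF oppr_eq0.
  rewrite paddr_eq0 ?sqr_ge0 // !sqrf_eq0; case/andP=> /eqP c1 /eqP c2.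
  have c0 : c j = 0 by apply/eqP; rewrite eq_complex c1 c2 !eqxx.
  by have [-> e] := vc j; rewrite -/(w j) e c0 !mul0r oppr0.
- by apply: cancel_s; exact: psd_form0_kernel ImTs Tpsd q10.
- by apply: cancel_s; exact: psd_form0_kernel ImTs Tpsd q20.
Qed.

(** The determinant with row [j] replaced is a linear form in the cofactors of row
    [j].  These are [q j * v l] for a real kernel vector [v] spanning the kernel;
    [q] is a left kernel vector, and by symmetry of [T] the vector [mu * q] is a
    right kernel vector, so [q] is proportional to the coefficients [c] of
    [v = c * mu].  This makes the form proportional to [c j ^+ 2]. *)
Lemma real_pencil_ray (R : realType) (n : nat) (T : 'M[R[i]]_n) (s : R)
    (lam mu : 'I_n -> R) :
  s != 0 -> (forall j l, T j l = T l j) ->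
  (forall y : 'I_n -> R, 0 <= \sum_j \sum_l y j * y l * (s * complex.Im (T j l))) ->
  (forall j, (lam j != 0) || (mu j != 0)) ->
  let lamC j := (lam j)%:C in let muC j := (mu j)%:C in
  \det (pencil T lamC muC) = 0 ->
  exists (g : R[i]) (c : 'I_n -> R), forall j (x y : R),
    \det (pencil T [eta lamC with j |-> x%:C] [eta muC with j |-> y%:C]) =
    g * (c j ^+ 2 * (x * mu j - y * lam j))%:C.
Proof.
move=> s0 Ts Tpsd nz lamC muC /[dup] M0 /det_eq0P [w [i wi] Mw].
set M := pencil T lamC muC in M0 Mw *.
have nzC j : (lamC j != 0) || (muC j != 0).
  by have := nz j; rewrite /lamC /muC !(fmorph_eq0 (real_complex R)).
have diss j : 0 <= s * complex.Im (lamC j * (muC j)^*).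
  by rewrite /= !(oppr0, mulr0, mul0r, addr0).
have kerE (v : 'I_n -> R[i]) : (forall j, \sum_l M j l * v l = 0) <->
    (forall j, lamC j * v j + muC j * \sum_l T j l * v l = 0).
  by split=> h j; have := h j; rewrite pencil_mulE.
pose A j l := complex.Re (T j l).
(* Im T annihilates the real and imaginary parts of w, so each of them is in the
   kernel. *)
have [v [v0 vker]] : exists v : 'I_n -> R, (exists j, v j != 0) /\
    forall j, (\sum_l T j l * (v l)%:C = (\sum_l A j l * v l)%:C) /\
              lam j * v j + mu j * \sum_l A j l * v l = 0.
  have kw := (kerE w).1 Mw.
  have [_ BR BI] := dissipative_kernel s0 Ts Tpsd nzC diss kw.
  have TR (x : 'I_n -> R) : (forall j, \sum_l complex.Im (T j l) * x l = 0) ->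
      forall j, \sum_l T j l * (x l)%:C = (\sum_l A j l * x l)%:C.
    move=> h j; apply/eqP; rewrite eq_complex Re_sum Im_sum /=; apply/andP; split; apply/eqP.
      by apply: eq_bigr => l _; rewrite /A; case: (T j l) => ? ? /=; ring.
    by rewrite -[RHS](h j); apply: eq_bigr => l _; case: (T j l) => ? ? /=; ring.
  have wE l : w l = (complex.Re (w l))%:C + 'i * (complex.Im (w l))%:C by exact: complexE.
  have TwE j : \sum_l T j l * w l =
      (\sum_l A j l * complex.Re (w l))%:C + 'i * (\sum_l A j l * complex.Im (w l))%:C.
    rewrite -(TR _ BR) -(TR _ BI) mulr_sumr -big_split; apply: eq_bigr => l _ /=.
    by rewrite {1}wE; ring.
  have parts j : lam j * complex.Re (w j) + mu j * \sum_l A j l * complex.Re (w l) = 0 /\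
                 lam j * complex.Im (w j) + mu j * \sum_l A j l * complex.Im (w l) = 0.
    have := kw j; rewrite TwE {1}(wE j) /lamC /muC => /eqP.
    rewrite eq_complex /= => /andP[/eqP h1 /eqP h2]; split.
      by rewrite -[RHS]h1; ring.
    by rewrite -[RHS]h2; ring.
  have [r0|r0] := eqVneq (complex.Re (w i)) 0.
    exists (fun l => complex.Im (w l)); split.
      exists i; apply: contraNneq wi => i0.
      by apply/eqP; rewrite [LHS](wE i) r0 i0 mulr0 addr0.
    by move=> j; split; [exact: TR|have [_] := parts j].
  exists (fun l => complex.Re (w l)); split; first by exists i.
  by move=> j; split; [exact: TR|have [] := parts j].
pose tau j := \sum_l A j l * v l.
have vM : forall j, \sum_l M j l * (v l)%:C = 0.
  apply/kerE => j; have [-> e] := vker j.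
  by rewrite /lamC /muC -!rmorphM -rmorphD e.
have [c vc] : exists c : 'I_n -> R, forall j, v j = c j * mu j /\ tau j = - (c j * lam j).
  have e j : {c | v j = c * mu j /\ tau j = - (c * lam j)}.
    apply: cid; have [c e1 e2] := proportional_pair (nz j) (vker j).2.
    by exists c.
  by exists (fun j => projT1 (e j)) => j; case: (e j).
have [[[j0 i0] /= k0]|nocof] :=
  pselect (exists p : 'I_n * 'I_n, cofactor M p.1 p.2 != 0); last first.
  exists 0, c => j x y; rewrite mul0r (det_pencil_cofactor _ lamC muC) big1 // => l _.
  have -> : cofactor (pencil T lamC muC) j l = 0; last by rewrite mulr0.
  by apply/eqP; apply: contrapT => /negP k; apply: nocof; exists (j, l).
have vi0 : (v i0)%:C != 0.
  have [j vj] := v0; apply: contraNneq vj => vi.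
  have := cofactor_kernel k0 vM vi j => /eqP.
  by rewrite (fmorph_eq0 (real_complex R)).
have prop (x : 'I_n -> R[i]) : (forall j, \sum_l M j l * x l = 0) ->
    forall l, x l = x i0 / (v i0)%:C * (v l)%:C.
  move=> Mx l; apply/eqP; rewrite -subr_eq0; apply/eqP.
  apply: (cofactor_kernel (v := fun l => x l - x i0 / (v i0)%:C * (v l)%:C) k0).
    move=> j; transitivity (\sum_l M j l * x l - x i0 / (v i0)%:C * \sum_l M j l * (v l)%:C).
      by rewrite mulr_sumr -sumrB; apply: eq_bigr => m _; ring.
    by rewrite Mx vM mulr0 subr0.
  by rewrite divfK // subrr.
(* Each row of cofactors is in the kernel of M, which is the line of v. *)
pose q j := cofactor M j i0 / (v i0)%:C.
have kq j l : cofactor M j l = q j * (v l)%:C.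
  suff Mc : forall m, \sum_l' M m l' * cofactor M j l' = 0.
    exact: (prop (cofactor M j) Mc l).
  move=> m.
  have /matrixP /(_ m j) := mul_mx_adj M.
  rewrite M0 [LHS]mxE [RHS]mxE mul0rn => h; rewrite -[RHS]h.
  by apply: eq_bigr => l' _; rewrite [\adj M _ _]mxE.
have qM l : \sum_j q j * M j l = 0.
  have /matrixP /(_ i0 l) := mul_adj_mx M.
  rewrite M0 [LHS]mxE [RHS]mxE mul0rn => /(congr1 (fun z => z / (v i0)%:C)).
  rewrite mul0r => h.
  rewrite -[RHS]h mulr_suml; apply: eq_bigr => j _.
  by rewrite [\adj M _ _]mxE /q mulrAC.
(* By symmetry of T, the left kernel vector q yields a right one. *)
pose x j := muC j * q j.
have Tx l : \sum_j T l j * x j = - (lamC l * q l).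
  apply/eqP; rewrite -addr_eq0 addrC; apply/eqP; rewrite -[RHS](qM l).
  transitivity (\sum_j (lamC j * q j) *+ (j == l) + \sum_j T l j * x j).
    by rewrite sum_delta.
  rewrite -big_split; apply: eq_bigr => j _ /=.
  by rewrite mxE (Ts j l) /x; case: eqP => _; rewrite ?mulr1n ?mulr0n; ring.
have xker : forall j, \sum_l M j l * x l = 0.
  by apply/kerE => j; rewrite Tx /x; ring.
pose g := x i0 / (v i0)%:C.
have xg l : x l = g * (v l)%:C by exact: prop.
have qc j : q j = g * (c j)%:C.
  have [e1 e2] := vc j; have /orP[l0|m0] := nzC j.
    apply: (mulfI l0); apply: (can_inj (@opprK _)); rewrite -Tx.
    under eq_bigr do rewrite xg mulrCA.
    by rewrite -mulr_sumr (vker j).1 -/(tau j) e2 /lamC rmorphN rmorphM; ring.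
  apply: (mulfI m0); rewrite -/(x j) xg e1 /muC rmorphM; ring.
exists g, c => j y z; rewrite (det_pencil_cofactor _ lamC muC).
under eq_bigr do rewrite kq.
transitivity (q j * (\sum_l (y%:C * (v l)%:C) *+ (l == j) +
  z%:C * \sum_l T j l * (v l)%:C)).
  rewrite mulr_sumr -big_split mulr_sumr; apply: eq_bigr => l _ /=.
  by rewrite eq_sym; case: eqP => _; rewrite ?mulr1n ?mulr0n; ring.
rewrite sum_delta (vker j).1 -/(tau j) qc; have [-> ->] := vc j.
by rewrite -mulrA -!rmorphM -rmorphD -rmorphM; congr (_ * _%:C); ring.
Qed.

(** * Continuity of complex-valued functions *)
Lemma continuous_mulf (K : numFieldType) (X : topologicalType) (f g : X -> K) :
  continuous f -> continuous g -> continuous (fun x => f x * g x).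
Proof. by move=> cf cg x; apply: cvgM; [exact: cf|exact: cg]. Qed.

Lemma continuous_addf (K : numFieldType) (X : topologicalType) (f g : X -> K) :
  continuous f -> continuous g -> continuous (fun x => f x + g x).
Proof. by move=> cf cg x; apply: cvgD; [exact: cf|exact: cg]. Qed.

Lemma continuous_oppf (K : numFieldType) (X : topologicalType) (f : X -> K) :
  continuous f -> continuous (fun x => - f x).
Proof. by move=> cf x; apply: cvgN; exact: cf. Qed.

Lemma continuous_cst (X Y : topologicalType) (c : Y) : continuous (fun _ : X => c).
Proof. by move=> x; exact: cvg_cst. Qed.

Lemma continuous_idf (X : topologicalType) : continuous (fun x : X => x).
Proof. by move=> x; exact: cvg_id. Qed.

Lemma continuous_comp_fun (X Y Z : topologicalType) (f : X -> Y) (g : Y -> Z) :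
  continuous f -> continuous g -> continuous (fun x => g (f x)).
Proof. by move=> cf cg x; apply: continuous_comp; [exact: cf|exact: cg]. Qed.

(** The topology of [R[i]] is that of an abstract [numFieldType]; this name lets
    unification find it. *)
Definition Cnum (R : realType) : numFieldType := R[i].

Lemma continuous_Re (R : realType) : continuous (@complex.Re R : Cnum R -> R).
Proof.
move=> z; apply/(@cvgrPdist_lt _ _ _ _ (nbhs_filter (z : Cnum R))) => e e0.
have e0C : 0 < e%:C by rewrite ltcR.
apply: filterS (@nbhsx_ballx _ (Cnum R) z _ e0C) => w h.
rewrite -ltcR; apply: le_lt_trans h.
by have := normc_ge_Re (z - w); rewrite raddfB.
Qed.

Lemma continuous_Im (R : realType) : continuous (@complex.Im R : Cnum R -> R).
Proof.
have -> : @complex.Im R = (fun z => complex.Re (- 'i * z)).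
  by apply/funext => -[a b] /=; ring.
apply: (@continuous_comp_fun (Cnum R) (Cnum R) R).
  apply: (@continuous_mulf (Cnum R) (Cnum R)); first exact: continuous_cst.
  exact: continuous_idf.
exact: continuous_Re.
Qed.

Lemma continuous_real_complex (R : realType) : continuous (real_complex R : R -> Cnum R).
Proof.
move=> x; apply/cvgrPdist_lt => e e0.
have [e' ee] : exists e', e = e'%:C by exact/complex_realP/gtr0_real.
move: e0; rewrite ee ltcR => e0.
apply: filterS (@nbhsx_ballx _ R x _ e0) => y h.
by rewrite -rmorphB /= normc_def /= expr0n addr0 sqrtr_sqr ltcR.
Qed.

Lemma continuous_complex (R : realType) (X : topologicalType) (f g : X -> R) :
  continuous f -> continuous g -> continuous (fun x => (f x +i* g x) : Cnum R).
Proof.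
move=> cf cg.
have -> : (fun x => (f x +i* g x) : Cnum R) =
  (fun x => ((f x)%:C : Cnum R) + ('i : Cnum R) * ((g x)%:C : Cnum R)).
  by apply/funext => x; rewrite [LHS]complexE.
apply: (@continuous_addf (Cnum R)).
  by apply: continuous_comp_fun cf _; exact: continuous_real_complex.
apply: (@continuous_mulf (Cnum R)); first exact: continuous_cst.
by apply: continuous_comp_fun cg _; exact: continuous_real_complex.
Qed.

Lemma continuous_conjc (R : realType) : continuous (@conjc R : Cnum R -> Cnum R).
Proof.
have -> : @conjc R = (fun z : Cnum R => complex.Re z +i* (- complex.Im z)).
  by apply/funext => -[].
apply: (@continuous_complex R (Cnum R)); first exact: continuous_Re.
by apply: continuous_oppf; exact: continuous_Im.
Qed.

Lemma continuous_cexp (R : realType) : continuous (@cexp R : Cnum R -> Cnum R).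
Proof.
have toR (f : R -> R) (g : Cnum R -> R) : continuous f -> continuous g ->
    continuous (fun z => f (g z)).
  by move=> cf cg; exact: continuous_comp_fun cg cf.
apply: (@continuous_mulf (Cnum R) (Cnum R) (fun z => (expR (complex.Re z))%:C)
  (fun z => cos (complex.Im z) +i* sin (complex.Im z))).
  apply: (@continuous_comp_fun (Cnum R) R (Cnum R)); last exact: continuous_real_complex.
  by apply: toR; [exact: continuous_expR|exact: continuous_Re].
apply: continuous_complex; apply: toR; try exact: continuous_Im.
  exact: continuous_cos.
exact: continuous_sin.
Qed.

Lemma continuous_det (K : numFieldType) (X : topologicalType) (n : nat)
    (M : X -> 'M[K]_n) :
  (forall j l, continuous (fun x => M x j l)) -> continuous (fun x => \det (M x)).
Proof.
move=> cM x; apply: cvg_sumr => s; apply: cvgM; first exact: cvg_cst.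
by apply: cvg_big => [|i _]; [exact: mul_continuous|exact: cM].
Qed.

(** * Zeros of bilinear functions of two parameters *)
Lemma mulcJ_real (R : realType) (w : R[i]) :
  w * w^* = (complex.Re w ^+ 2 + complex.Im w ^+ 2)%:C.
Proof.
by case: w => a b; apply/eqP; rewrite eq_complex /=; apply/andP; split; apply/eqP; ring.
Qed.

Lemma Re2Im2_gt0 (R : realType) (w : R[i]) : w != 0 ->
  0 < complex.Re w ^+ 2 + complex.Im w ^+ 2.
Proof.
rewrite eq_complex negb_and /= => /orP[] h.
  by rewrite ltr_pwDl ?sqr_ge0 // exprn_even_gt0.
by rewrite ltr_wpDl ?sqr_ge0 // exprn_even_gt0.
Qed.

Lemma real_ratio (R : realType) (u w : R[i]) :
  w != 0 -> complex.Im (u * w^*) = 0 -> exists s : R, u + w * s%:C = 0.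
Proof.
move=> w0 h; set n := complex.Re w ^+ 2 + complex.Im w ^+ 2.
have n0 : n != 0 by rewrite gt_eqF // Re2Im2_gt0.
have nC : n%:C != 0 by rewrite (fmorph_eq0 (real_complex R)).
exists (- complex.Re (u * w^*) / n).
have uE : u * w^* = (complex.Re (u * w^*))%:C by rewrite [LHS]complexE h mulr0 addr0.
have wJ : w^* != 0 by rewrite conjc_eq0.
apply: (mulIf wJ); rewrite mul0r mulrDl mulrAC mulcJ_real -/n uE -rmorphM -rmorphD.
by rewrite [n * _]mulrC divfK // addrN.
Qed.

Lemma ivt_zero (R : realType) (f : R -> R) (a b : R) :
  a <= b -> continuous f -> f a * f b <= 0 -> exists2 c, a <= c <= b & f c = 0.
Proof.
move=> ab cf fab.
have [|c] := @IVT R f a b 0 ab (continuous_subspaceT cf); last first.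
  by rewrite in_itv /=; exists c.
case: (ltP (f a) (f b)) => h;
  rewrite ?(min_l (ltW h)) ?(max_r (ltW h)) ?(min_r h) ?(max_l h); nra.
Qed.

(** For real [t], the number [s = - (A + C t) / (B + E t)] is real when the quadratic
    [Im ((A + C t) conj (B + E t))] vanishes.  At [k] this quadratic is
    [t Im (C conj B) + t^2 Im (C conj E)], which changes sign between [- t0] and [t0]; the
    sign change persists near [k]. *)
Lemma bilinear_real_zero (R : realType) (A B C E : Cnum R -> Cnum R) (k : Cnum R) :
  continuous A -> continuous B -> continuous C -> continuous E ->
  A k = 0 -> complex.Im (C k * (B k : R[i])^*) != 0 ->
  \forall z \near k, exists s t : R,
    A z + B z * s%:C + C z * t%:C + E z * (s%:C * t%:C) = 0.
Proof.
move=> cA cB cC cE Ak CBk.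
pose I2 (f g : Cnum R -> Cnum R) z := complex.Im ((f z : R[i]) * (g z : R[i])^*).
have cI2 f g : continuous f -> continuous g -> continuous (I2 f g : Cnum R -> R).
  move=> cf cg; apply: (@continuous_comp_fun _ (Cnum R) R); last exact: continuous_Im.
  apply: (@continuous_mulf (Cnum R)); first exact: cf.
  by apply: continuous_comp_fun cg _; exact: continuous_conjc.
pose q z t := I2 A B z + t * (I2 A E z + I2 C B z) + t * t * I2 C E z.
have qE z t : q z t = complex.Im ((A z + C z * t%:C) * (B z + E z * t%:C)^*).
  rewrite /q /I2; case: (A z) (B z) (C z) (E z) => [? ?] [? ?] [? ?] [? ?] /=; ring.
pose a := I2 C B; pose b := I2 C E.
(* Small enough for the linear term a t to dominate b t^2. *)
pose t0 := `|a k| / (2 * (`|b k| + 1)).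
have ak : 0 < `|a k| by rewrite normr_gt0.
have bk : 0 <= `|b k| by [].
have t00 : 0 < t0 by rewrite /t0 divr_gt0 // mulr_gt0 // ltr_wpDl.
have t0b : t0 * `|b k| < `|a k|.
  rewrite /t0 mulrAC ltr_pdivrMr; last by rewrite mulr_gt0 // ltr_wpDl.
  nra.
have near1 : \forall z \near k, t0 * `|b z| < `|a z|.
  have c1 : continuous (fun z : Cnum R => `|a z| - t0 * `|b z|).
    apply: continuous_addf.
      by apply: continuous_comp_fun (cI2 _ _ cC cB) _; exact: norm_continuous.
    apply: continuous_oppf; apply: continuous_mulf; first exact: continuous_cst.
    by apply: continuous_comp_fun (cI2 _ _ cC cE) _; exact: norm_continuous.
  have p : 0 < `|a k| - t0 * `|b k| by rewrite subr_gt0.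
  by apply: filterS (cvgr_gt _ (c1 k) _ p) => z; rewrite subr_gt0.
have cq t : continuous (q ^~ t : Cnum R -> R).
  apply: continuous_addf; first apply: continuous_addf.
  - exact: cI2.
  - apply: continuous_mulf; first exact: continuous_cst.
    by apply: continuous_addf; exact: cI2.
  - by apply: continuous_mulf; [exact: continuous_cst|exact: cI2].
have near2 : \forall z \near k, q z (- t0) * q z t0 < 0.
  have c2 : continuous (fun z : Cnum R => q z (- t0) * q z t0).
    by apply: continuous_mulf; exact: cq.
  apply: (cvgr_lt _ (c2 k)).
  have -> : q k (- t0) * q k t0 = t0 ^+ 2 * ((t0 * b k) ^+ 2 - a k ^+ 2).
    by rewrite /q -/(b k) -/(a k) /I2 Ak !mul0r /=; ring.
  rewrite pmulr_rlt0 ?exprn_gt0 // subr_lt0.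
  rewrite -(real_normK (num_real (a k))) -(real_normK (num_real (t0 * b k))).
  by rewrite ltrXn2r ?nnegrE // normrM (gtr0_norm t00).
apply: filterS2 near1 near2 => z z1 z2.
have cqz : continuous (q z).
  move=> t; apply: cvgD; last by apply: cvgM; [apply: cvgM; exact: cvg_id|exact: cvg_cst].
  by apply: cvgD; [exact: cvg_cst|apply: cvgM; [exact: cvg_id|exact: cvg_cst]].
have [|t /andP[tl tr] qt] := ivt_zero _ cqz (ltW z2); first lra.
have w0 : B z + E z * t%:C != 0.
  (* Otherwise a z + t b z = Im (C conj (B + E t)) = 0, against the choice of t0. *)
  apply/eqP => w0.
  have : a z + t * b z = complex.Im ((C z : R[i]) * (B z + E z * t%:C)^*).
    by rewrite /a /b /I2; case: (B z) (C z) (E z) => [? ?] [? ?] [? ?] /=; ring.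
  have im0 (u w : R[i]) : w = 0 -> complex.Im (u * w^*) = 0.
    by move=> ->; case: u => ? ? /=; ring.
  rewrite (im0 _ _ w0) => e.
  have : `|a z| <= t0 * `|b z|.
    have -> : a z = - (t * b z) by lra.
    by rewrite normrN normrM ler_wpM2r // ler_norml tl tr.
  by rewrite leNgt z1.
have [|s us] := @real_ratio R (A z + C z * t%:C) _ w0; first by rewrite -qE.
by exists s, t; rewrite -[RHS]us; ring.
Qed.

(** If [C / B] is not a nonnegative real, some open half-plane point [t0] has
    [- t0 C / B] in the same open half-plane.  With [t = d t0] for a small fixed
    [d], the solution [s = - (A + C t) / (B + E t)] is then in the open half-plane at
    [k], hence also near [k]. *)
Lemma bilinear_half_plane_zero (R : realType) (A B C E : Cnum R -> Cnum R)
    (k : Cnum R) (sg : R) :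
  continuous A -> continuous B -> continuous C -> continuous E ->
  sg != 0 -> A k = 0 -> B k != 0 ->
  ~ (exists2 r : R, 0 <= r & C k = B k * r%:C) ->
  \forall z \near k, exists s t : R[i],
    [/\ 0 <= sg * complex.Im s, 0 <= sg * complex.Im t &
    A z + B z * s + C z * t + E z * (s * t) = 0].
Proof.
move=> cA cB cC cE sg0 Ak Bk noray.
have [t0 [t0p t0n]] : exists t0 : R[i], 0 < sg * complex.Im t0 /\
    0 < sg * complex.Im (- (C k * t0) * (B k : R[i])^*).
  pose x := complex.Re ((C k : R[i]) * (B k : R[i])^*).
  pose y := complex.Im ((C k : R[i]) * (B k : R[i])^*).
  have e (u v : R) : complex.Im (- (C k * (u +i* v)) * (B k : R[i])^*) = - (x * v + y * u).
    by rewrite /x /y; case: (B k) (C k) => [? ?] [? ?] /=; ring.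
  have sg2 : 0 < sg * sg by rewrite -expr2 exprn_even_gt0.
  have [y0|y0] := eqVneq y 0; last first.
    exists ((- (x + 1) / y * sg) +i* sg); rewrite e /=; split=> //.
    have -> : sg * - (x * sg + y * (- (x + 1) / y * sg)) = sg * sg by field.
    by [].
  have x0 : x < 0.
    rewrite ltNge; apply/negP => x0; apply: noray.
    set n := complex.Re (B k : R[i]) ^+ 2 + complex.Im (B k : R[i]) ^+ 2.
    have n0 : 0 < n by exact: Re2Im2_gt0.
    exists (x / n); first by rewrite divr_ge0 // ltW.
    have BJ : (B k : R[i])^* != 0 by rewrite conjc_eq0.
    apply: (mulIf BJ).
    have xE : (C k : R[i]) * (B k : R[i])^* = x%:C.
      by rewrite [LHS]complexE -/x -/y y0 mulr0 addr0.
    have nE : (B k : R[i]) * (B k : R[i])^* = n%:C by exact: mulcJ_real.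
    transitivity (x%:C : R[i]); first exact: xE.
    transitivity (n%:C * (x / n)%:C : R[i]); last by rewrite -nE; ring.
    by rewrite -rmorphM mulrC divfK // gt_eqF.
  by exists (0 +i* sg); rewrite e /=; split=> //; rewrite y0; nra.
pose w d z : R[i] := B z + E z * (d%:C * t0).
pose u d z : R[i] := - (A z + C z * (d%:C * t0)).
pose g0 := sg * complex.Im (- (C k * t0) * (B k : R[i])^*).
pose g1 := sg * complex.Im (- (C k * t0) * (E k * t0 : R[i])^*).
(* Small enough for E t to be negligible against B. *)
pose d := g0 / (2 * (`|g1| + 1)).
have g1p : 0 <= `|g1| by [].
have d0 : 0 < d by rewrite /d divr_gt0 // mulr_gt0 // ltr_wpDl.
have dg : d * `|g1| < g0.
  rewrite /d mulrAC ltr_pdivrMr; last by rewrite mulr_gt0 // ltr_wpDl.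
  have : 0 < g0 by []. nra.
have hk : 0 < sg * complex.Im (u d k * (w d k)^*).
  have -> : sg * complex.Im (u d k * (w d k)^*) = d * (g0 + d * g1).
    have gen (b c e t : R[i]) (x : R) :
        sg * complex.Im (- (0 + c * (x%:C * t)) * (b + e * (x%:C * t))^*) =
        x * (sg * complex.Im (- (c * t) * b^*) +
             x * (sg * complex.Im (- (c * t) * (e * t)^*))).
      by case: b c e t => [? ?] [? ?] [? ?] [? ?] /=; ring.
    by rewrite /u /w Ak gen.
  rewrite mulr_gt0 //; have := ler_norm (- (d * g1)).
  rewrite normrN normrM (gtr0_norm d0); lra.
have ch : continuous (fun z : Cnum R => sg * complex.Im (u d z * (w d z)^*)).
  have c1 (f g : Cnum R -> Cnum R) (c : Cnum R) : continuous f -> continuous g ->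
     continuous (fun z => f z + g z * c).
    move=> cf cg; apply: (@continuous_addf (Cnum R)); first exact: cf.
    by apply: (@continuous_mulf (Cnum R)); [exact: cg|exact: continuous_cst].
  apply: continuous_mulf; first exact: continuous_cst.
  apply: (@continuous_comp_fun _ (Cnum R) R); last exact: continuous_Im.
  apply: (@continuous_mulf (Cnum R)); first by apply: (@continuous_oppf (Cnum R)); exact: c1.
  by apply: continuous_comp_fun (c1 _ _ _ cB cE) _; exact: continuous_conjc.
apply: filterS (cvgr_gt _ (ch k) _ hk) => z hz.
have w0 : w d z != 0.
  apply: contraTneq hz => ->; rewrite -leNgt.
  have -> : complex.Im (u d z * (0 : R[i])^*) = 0 by case: (u d z) => ? ? /=; ring.
  by rewrite mulr0.
set n := complex.Re (w d z) ^+ 2 + complex.Im (w d z) ^+ 2.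
have n0 : 0 < n by exact: Re2Im2_gt0.
exists (u d z / w d z), (d%:C * t0); split.
- have -> : u d z / w d z = (n^-1)%:C * (u d z * (w d z)^*).
    apply: (mulIf w0); rewrite divfK //.
    transitivity (u d z * ((n^-1)%:C * n%:C)); first
      by rewrite -rmorphM mulVf ?mulr1 // gt_eqF.
    by rewrite -mulcJ_real; ring.
  have -> (x : R[i]) : sg * complex.Im ((n^-1)%:C * x) = n^-1 * (sg * complex.Im x).
    by case: x => ? ? /=; ring.
  by apply: mulr_ge0; [rewrite invr_ge0|]; apply: ltW.
- have -> : sg * complex.Im (d%:C * t0) = d * (sg * complex.Im t0).
    by case: (t0) => ? ? /=; ring.
  by rewrite mulr_ge0 // ltW.
- transitivity (A z + C z * (d%:C * t0) + w d z * (u d z / w d z)).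
    by rewrite /w; ring.
  by rewrite [w d z * _]mulrC divfK // /u subrr.
Qed.

(** * From dissipative to real parameters *)
Lemma det_pencil_rowD (F : comNzRingType) (n : nat) (T : 'M[F]_n)
    (lam mu : 'I_n -> F) j (x y s : F) :
  \det (pencil T [eta lam with j |-> lam j + s * x] [eta mu with j |-> mu j + s * y]) =
  \det (pencil T lam mu) + s * \det (pencil T [eta lam with j |-> x] [eta mu with j |-> y]).
Proof.
have own : \det (pencil T lam mu) =
    \det (pencil T [eta lam with j |-> lam j] [eta mu with j |-> mu j]).
  by congr (\det _); apply: eq_pencil => i /=; case: eqP => // ->.
have e a b := det_pencil_row T lam mu j a b.
set P := \det (pencil T [eta lam with j |-> 1] _) in e.
set Q := \det (pencil T [eta lam with j |-> 0] _) in e.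
by rewrite own 3!e; ring.
Qed.

(** The two rows [j] and [l] are moved along [x], by [s] and [t] respectively. *)
Definition shift2 (F : pzSemiRingType) (n : nat) (lam x : 'I_n -> F)
    (j l : 'I_n) (s t : F) : 'I_n -> F :=
  [eta lam with j |-> lam j + s * x j, l |-> lam l + t * x l].

Lemma det_pencil_shift2 (F : comNzRingType) (n : nat) (T : 'M[F]_n)
    (lam mu x y : 'I_n -> F) j l (s t : F) : j != l ->
  \det (pencil T (shift2 lam x j l s t) (shift2 mu y j l s t)) =
  \det (pencil T lam mu)
  + \det (pencil T [eta lam with j |-> x j] [eta mu with j |-> y j]) * s
  + \det (pencil T [eta lam with l |-> x l] [eta mu with l |-> y l]) * t
  + \det (pencil T [eta lam with j |-> x j, l |-> x l]
                   [eta mu with j |-> y j, l |-> y l]) * (s * t).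
Proof.
move=> jl.
have lj : l != j by rewrite eq_sym.
pose lam' := [eta lam with l |-> lam l + t * x l].
pose mu' := [eta mu with l |-> mu l + t * y l].
have lj' (f g : 'I_n -> F) : [eta f with l |-> g l] j = f j by rewrite /= (negbTE jl).
transitivity (\det (pencil T [eta lam' with j |-> lam' j + s * x j]
  [eta mu' with j |-> mu' j + s * y j])).
  by rewrite /lam' /mu' /= (negbTE jl).
rewrite det_pencil_rowD /lam' /mu' det_pencil_rowD.
pose lam2 := [eta lam with j |-> x j]; pose mu2 := [eta mu with j |-> y j].
have -> : \det (pencil T [eta [eta lam with l |-> lam l + t * x l] with j |-> x j]
     [eta [eta mu with l |-> mu l + t * y l] with j |-> y j]) =
   \det (pencil T [eta lam2 with l |-> lam2 l + t * x l]
     [eta mu2 with l |-> mu2 l + t * y l]).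
  congr (\det _); apply: eq_pencil => i; rewrite /lam2 /mu2 /= (negbTE lj);
    by case: (eqVneq i j) => // ->; rewrite (negbTE jl).
rewrite det_pencil_rowD.
have -> : \det (pencil T [eta lam2 with l |-> x l] [eta mu2 with l |-> y l]) =
    \det (pencil T [eta lam with j |-> x j, l |-> x l] [eta mu with j |-> y j, l |-> y l]).
  congr (\det _); apply: eq_pencil => i; rewrite /lam2 /mu2 /=;
    by case: (eqVneq i j) => // ->; rewrite (negbTE jl).
by rewrite /lam2 /mu2; ring.
Qed.

Lemma continuous_det_pencil (K : numFieldType) (X : topologicalType) (n : nat)
    (T : X -> 'M[K]_n) (lam mu : 'I_n -> K) :
  (forall j l, continuous (fun x => T x j l)) ->
  continuous (fun x => \det (pencil (T x) lam mu)).
Proof.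
move=> cT; apply: continuous_det => j l.
have -> : (fun x => pencil (T x) lam mu j l) =
  (fun x => lam j *+ (j == l) + mu j * T x j l).
  by apply/funext => x; rewrite mxE.
apply: continuous_addf; first exact: continuous_cst.
by apply: continuous_mulf; [exact: continuous_cst|exact: cT].
Qed.

(** The pairs are made real one index at a time.  As a function of the pair at one
    index the determinant is [lam P(t) + mu Q(t)] at [z = f - i t], and its zero
    [(Q, - P)] has dissipation [s Im (P conj Q)].  This is nonnegative at the given
    [t]; at [t = 0] it cannot be positive, for then [dissipative_kernel] would make
    row [jm] irrelevant and [P = Q = 0].  At an intermediate zero the pair
    [(Q, - P)] is proportional to a real one. *)
Lemma dissipative_to_real (R : realType) (n : nat) (T : Cnum R -> 'M[Cnum R]_n)
    (f r0 s : R) (lam mu : 'I_n -> R[i]) :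
  (forall j l, continuous (fun z => T z j l)) ->
  (forall z j l, T z j l = T z l j) ->
  s != 0 ->
  (forall y : 'I_n -> R,
     0 <= \sum_j \sum_l y j * y l * (s * complex.Im (T f%:C j l))) ->
  0 <= r0 ->
  (forall j, (lam j != 0) || (mu j != 0)) ->
  (forall j, 0 <= s * complex.Im (lam j * (mu j)^*)) ->
  \det (pencil (T (f -i* r0)) lam mu) = 0 ->
  exists (r : R) (lam' mu' : 'I_n -> R),
    [/\ 0 <= r <= r0, (forall j, (lam' j != 0) || (mu' j != 0)) &
      \det (pencil (T (f -i* r)) (fun j => (lam' j)%:C) (fun j => (mu' j)%:C)) = 0].
Proof.
move=> cT Ts s0 Tpsd r00 nz diss D0.
(* Induction on the number m of indices at which the pair is already real. *)
suff /(_ n) [r [la [m [[r0r rr0] nz' _ [Rl Rm] D0']]]] : forall m : nat,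
    exists (r : R) (la mu : 'I_n -> R[i]),
    [/\ 0 <= r /\ r <= r0, (forall j, (la j != 0) || (mu j != 0)),
     (forall j, 0 <= s * complex.Im (la j * (mu j)^*)),
     (forall j : 'I_n, (j < m)%N -> complex.Im (la j) = 0) /\
     (forall j : 'I_n, (j < m)%N -> complex.Im (mu j) = 0) &
     \det (pencil (T (f -i* r)) la mu) = 0].
  have RE (u : 'I_n -> R[i]) : (forall j : 'I_n, (j < n)%N -> complex.Im (u j) = 0) ->
      forall j, u j = (complex.Re (u j))%:C.
    by move=> h j; rewrite [LHS]complexE h ?mulr0 ?addr0.
  exists r, (fun j => complex.Re (la j)), (fun j => complex.Re (m j)); split.
  - by rewrite r0r.
  - move=> j; have := nz' j; rewrite (RE _ Rl j) (RE _ Rm j).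
    by rewrite !(fmorph_eq0 (real_complex R)).
  - rewrite -[RHS]D0'; congr (\det _); apply: eq_pencil => j.
      by rewrite -(RE _ Rl).
    by rewrite -(RE _ Rm).
elim=> [|m [r [la [mm [[r0r rr0] nz' diss' [Rl Rm] D0']]]]].
  by exists r0, lam, mu; split.
have [mn|nm] := ltnP m n; last first.
  exists r, la, mm; split=> //; split=> j _; [apply: Rl|apply: Rm];
    exact: leq_trans (ltn_ord j) nm.
pose jm := Ordinal mn.
pose row (x y : R[i]) z : R[i] :=
  \det (pencil (T z) [eta la with jm |-> x] [eta mm with jm |-> y]).
pose P t := row 1 0 (f -i* t); pose Q t := row 0 1 (f -i* t).
have rowE x y t : row x y (f -i* t) = x * P t + y * Q t by exact: det_pencil_row.
have D0r : la jm * P r + mm jm * Q r = 0.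
  rewrite -rowE -[RHS]D0'; congr (\det _); apply: eq_pencil => j /=;
    by case: eqP => // ->.
pose g t := s * complex.Im (P t * (Q t)^*).
suff [r1 [x [y [r10 r1r xy0 xyD]]]] : exists (r1 x y : R),
    [/\ 0 <= r1, r1 <= r, (x != 0) || (y != 0) & x%:C * P r1 + y%:C * Q r1 = 0].
  exists r1, [eta la with jm |-> x%:C], [eta mm with jm |-> y%:C]; split.
  - by split=> //; exact: le_trans rr0.
  - move=> j /=; case: (eqVneq j jm) => // _.
    by rewrite !(fmorph_eq0 (real_complex R)).
  - move=> j /=; case: (eqVneq j jm) => // _.
    by rewrite /= !(oppr0, mulr0, mul0r, addr0).
  - by split=> j; rewrite ltnS leq_eqVlt /= -val_eqE /=;
      case: (eqVneq (val j) m) => //= _; [exact: Rl|exact: Rm].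
  - by rewrite -[RHS]xyD -rowE.
suff [r1 [r10 r1r gr1]] : exists r1, [/\ 0 <= r1, r1 <= r & g r1 = 0].
  have gI : complex.Im (P r1 * (Q r1)^*) = 0 by apply: (mulfI s0); rewrite mulr0.
  have [P0|P0] := eqVneq (P r1) 0.
    exists r1, 1, 0; split; [exact: r10|exact: r1r|by rewrite oner_neq0|].
    by rewrite P0 mulr0 mul0r addr0.
  have gI' : complex.Im (Q r1 * (P r1)^*) = 0.
    have -> : complex.Im (Q r1 * (P r1)^*) = - complex.Im (P r1 * (Q r1)^*).
      by case: (P r1) (Q r1) => [? ?] [? ?] /=; ring.
    by rewrite gI oppr0.
  have [x xE] := real_ratio P0 gI'.
  exists r1, x, 1; split; [exact: r10|exact: r1r|by rewrite oner_neq0 orbT|].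
  by rewrite -[RHS]xE; ring.
have gr_ge0 : 0 <= g r.
  have [c Pc Qc] := proportional_pair (nz' jm) D0r.
  have -> : g r =
      (complex.Re c ^+ 2 + complex.Im c ^+ 2) * (s * complex.Im (la jm * (mm jm)^*)).
    rewrite /g Pc Qc; case: c (la jm) (mm jm) {Pc Qc} => [? ?] [? ?] [? ?] /=; ring.
  by rewrite mulr_ge0 // addr_ge0 ?sqr_ge0.
have g0_le0 : g 0 <= 0.
  rewrite leNgt; apply/negP => g0.
  have PQ0 : (P 0, Q 0) <> (0, 0).
    by move=> [P0 _]; move: g0; rewrite /g P0 mul0r /= mulr0 ltxx.
  pose la' := [eta la with jm |-> Q 0]; pose mm' := [eta mm with jm |-> - P 0].
  have f0 : f -i* 0 = f%:C by rewrite oppr0.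
  have nz2 j : (la' j != 0) || (mm' j != 0).
    rewrite /la' /mm' /=; case: (eqVneq j jm) => // _; rewrite oppr_eq0.
    have [q0|q0] := eqVneq (Q 0) 0; last by apply/orP; left.
    have [p0|p0] := eqVneq (P 0) 0; last by apply/orP; right.
    by case: PQ0; rewrite p0 q0.
  have IE : complex.Im (Q 0 * (- P 0)^*) = complex.Im (P 0 * (Q 0)^*).
    by case: (P 0) (Q 0) => [? ?] [? ?] /=; ring.
  have diss2 j : 0 <= s * complex.Im (la' j * (mm' j)^*).
    by rewrite /la' /mm' /=; case: (eqVneq j jm) => // _; rewrite IE ltW.
  have D2 : \det (pencil (T (f -i* 0)) la' mm') = 0.
    by rewrite -/(row _ _ _) rowE; ring.
  have [v v0 vker] := (det_eq0P _).1 D2.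
  have ker2 j : la' j * v j + mm' j * \sum_l T f%:C j l * v l = 0.
    by rewrite -f0 -pencil_mulE.
  have Tsf j l : T f%:C j l = T f%:C l j by exact: Ts.
  have [vz _ _] := dissipative_kernel s0 Tsf Tpsd nz2 diss2 ker2.
  have [vj Tvj] : v jm = 0 /\ \sum_l T f%:C jm l * v l = 0.
    apply: vz; rewrite /la' /mm' /= eqxx IE.
    by apply/eqP => e; move: g0; rewrite /g e mulr0 ltxx.
  have row0 x y : row x y (f -i* 0) = 0.
    apply/det_eq0P; exists v => // j; rewrite pencil_mulE f0.
    have [->|jn] := eqVneq j jm; first by rewrite /= eqxx vj Tvj !mulr0 addr0.
    by have := ker2 j; rewrite /la' /mm' /= (negbTE jn).
  by apply: PQ0; rewrite /P /Q !row0.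
have crow x y : continuous (fun t : R => row x y (f -i* t) : Cnum R).
  apply: (@continuous_comp_fun R (Cnum R) (Cnum R) (fun t => f -i* t) (row x y)); last first.
    exact: continuous_det_pencil.
  apply: continuous_complex; first exact: continuous_cst.
  by apply: continuous_oppf; exact: continuous_idf.
have cg : continuous g.
  apply: continuous_mulf; first exact: continuous_cst.
  apply: (@continuous_comp_fun R (Cnum R) R); last exact: continuous_Im.
  apply: (@continuous_mulf (Cnum R) R); first exact: crow.
  by apply: (continuous_comp_fun (crow 0 1)); exact: continuous_conjc.
have [r1 /andP[r10 r1r] gr1] := ivt_zero r0r cg (mulr_le0_ge0 g0_le0 gr_ge0).
by exists r1; split.
Qed.

(** * The interaction matrix of the point centres *)
Definition interaction (R : realType) (N : nat) (Y : 'I_N -> 'rV[R]_3) (z : R[i]) :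
    'M[R[i]]_N := \matrix_(j, l) (diag_term z *+ (j == l) + Green0 z (Y j - Y l)).

Lemma eucl_normN (R : realType) (x : 'rV[R]_3) : eucl_norm (- x) = eucl_norm x.
Proof. by rewrite /eucl_norm; congr Num.sqrt; apply: eq_bigr => i _; rewrite mxE sqrrN. Qed.

Lemma eucl_normZ (R : realType) (c : R) (x : 'rV[R]_3) :
  eucl_norm (c *: x) = `|c| * eucl_norm x.
Proof.
rewrite /eucl_norm -sqrtr_sqr -sqrtrM ?sqr_ge0 // mulr_sumr.
by congr Num.sqrt; apply: eq_bigr => i _; rewrite mxE exprMn.
Qed.

Lemma eucl_norm_eq0 (R : realType) (x : 'rV[R]_3) : (eucl_norm x == 0) = (x == 0).
Proof.
apply/eqP/eqP => [e|->]; last first.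
  by rewrite -[0 in LHS](scale0r 0) eucl_normZ normr0 mul0r.
have h : \sum_(i < 3) x ord0 i ^+ 2 = 0.
  rewrite -[LHS]sqr_sqrtr ?sumr_ge0 // => [|i _];
    by rewrite ?sqr_ge0 // -/(eucl_norm x) e expr0n.
apply/rowP => i; rewrite mxE; apply/eqP; rewrite -sqrf_eq0.
have := psumr_eq0P (P := xpredT) (F := fun i => x ord0 i ^+ 2) (fun i _ => sqr_ge0 _) h.
by move=> /(_ i isT) ->.
Qed.

Lemma interaction_sym (R : realType) (N : nat) (Y : 'I_N -> 'rV[R]_3) z j l :
  interaction Y z j l = interaction Y z l j.
Proof.
rewrite !mxE eq_sym; congr (_ + _).
by rewrite /Green0 /Green -(opprB (Y j)) eucl_normN oppr_eq0.
Qed.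

(** At a real frequency the imaginary part of the outgoing Green function is
    [sin (f r) / (4 pi r)], and the diagonal term is its limit at [r = 0]. *)
Lemma interaction_psd (R : realType) (N : nat) (Y : 'I_N -> 'rV[R]_3) (f : R) :
  injective Y -> let s : R := if 0 <= f then 1 else -1 in
  forall y : 'I_N -> R,
    0 <= \sum_j \sum_l y j * y l * (s * complex.Im (interaction Y f%:C j l)).
Proof.
move=> Yinj s y.
have sf : s * f = `|f|.
  rewrite /s; case: leP => h; first by rewrite mul1r ger0_norm.
  by rewrite ltr0_norm // mulN1r.
have ssin r : s * sin (f * r) = sin (`|f| * r).
  rewrite -sf /s; case: leP => h; first by rewrite !mul1r.
  by rewrite !mulN1r mulNr sinN.
have p4 : 0 < 4 * pi :> R by rewrite mulr_gt0 // pi_gt0.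
have entry j l : s * complex.Im (interaction Y f%:C j l) =
    `|f| / (4 * pi) * sinc (eucl_norm (`|f| *: Y j - `|f| *: Y l)).
  have dI : complex.Im (diag_term f%:C) = f / (4 * pi).
    by rewrite /diag_term -fmorphV /=; ring.
  rewrite mxE; have [->|jl] := eqVneq j l.
    rewrite mulr1n /Green0 !subrr eqxx addr0 dI mulrA sf /sinc.
    by rewrite (_ : eucl_norm 0 = 0) ?eqxx ?mulr1 //; apply/eqP; rewrite eucl_norm_eq0.
  have Y0 : Y j - Y l != 0 by rewrite subr_eq0; apply: contraNneq jl => /Yinj ->.
  rewrite mulr0n add0r /Green0 (negbTE Y0) -scalerBr eucl_normZ normr_id.
  set r := eucl_norm _.
  have r0 : r != 0 by rewrite /r eucl_norm_eq0.
  have -> : complex.Im (Green f%:C (Y j - Y l)) = sin (f * r) / (4 * pi * r).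
    rewrite /Green -/r /cexp -fmorphV.
    have -> : 'i%C * f%:C * r%:C = 0 +i* (f * r).
      by apply/eqP; rewrite eq_complex /=; apply/andP; split; apply/eqP; ring.
    by rewrite /= expR0; ring.
  rewrite mulrA ssin /sinc; have [->|f0] := eqVneq f 0.
    by rewrite normr0 !mul0r sin0 mul0r.
  have af : `|f| != 0 by rewrite normr_eq0.
  rewrite mulf_eq0 (negbTE af) (negbTE r0) /=.
  have pi0 : pi != 0 :> R by rewrite gt_eqF // pi_gt0.
  by move: pi0; move: (pi) => p pi0; field; rewrite af r0 pi0.
under eq_bigr do under eq_bigr do rewrite entry mulrCA.
under eq_bigr do rewrite -mulr_sumr.
rewrite -mulr_sumr mulr_ge0 ?divr_ge0 ?normr_ge0 ?(ltW p4) //.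
exact: (sinc_kernel_ge0 y (fun j => `|f| *: Y j)).
Qed.

Lemma continuous_interaction (R : realType) (N : nat) (Y : 'I_N -> 'rV[R]_3) j l :
  continuous (fun z : Cnum R => interaction Y z j l : Cnum R).
Proof.
have cmul (c : Cnum R) : continuous (fun z : Cnum R => c * z).
  by apply: (@continuous_mulf (Cnum R)); [exact: continuous_cst|exact: continuous_idf].
have cmulr (f : Cnum R -> Cnum R) (c : Cnum R) :
    continuous f -> continuous (fun z : Cnum R => f z * c).
  by move=> cf; apply: (@continuous_mulf (Cnum R)); [exact: cf|exact: continuous_cst].
have -> : (fun z : Cnum R => interaction Y z j l : Cnum R) =
    (fun z : Cnum R => (diag_term z *+ (j == l) : Cnum R) + (Green0 z (Y j - Y l) : Cnum R)).
  by apply/funext => z; rewrite mxE.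
apply: (@continuous_addf (Cnum R)).
  case: (j == l); last exact: continuous_cst.
  apply: (cmulr (fun z => ('i : Cnum R) * z)); exact: cmul.
rewrite /Green0; case: eqP => _; first exact: continuous_cst.
apply: (cmulr (fun z : Cnum R => cexp ('i%C * z * (eucl_norm (Y j - Y l))%:C) : Cnum R)).
apply: (@continuous_comp_fun (Cnum R) (Cnum R) (Cnum R)
  (fun z => ('i : Cnum R) * z * ((eucl_norm (Y j - Y l))%:C : Cnum R)));
  last exact: continuous_cexp.
by apply: cmulr; exact: cmul.
Qed.

(** * The regularized determinant as a pencil *)
Definition row_lam (F : pzRingType) (T : eqType) (N : nat) (a : 'I_N -> option T)
  (beta : 'I_N -> F) (j : 'I_N) : F := if a j != None then - beta j else 1.

Definition row_mu (F : pzRingType) (T : eqType) (N : nat) (a : 'I_N -> option T)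
  (beta : 'I_N -> F) (j : 'I_N) : F := if a j != None then 1 else beta j.

Lemma reg_det_pencil (R : realType) (N : nat) (a : 'I_N -> ext R[i])
    (Y : 'I_N -> 'rV[R]_3) (beta : 'I_N -> R[i]) (z : R[i]) :
  reg_det a Y beta z = (-1) ^+ #|finite_idx a| *
    \det (pencil (interaction Y z) (row_lam a beta) (row_mu a beta)).
Proof.
congr (_ * \det _); apply/matrixP => j l; rewrite !mxE /row_lam /row_mu.
case: (a j != None); case: (j == l); rewrite ?mulr1n ?mulr0n; ring.
Qed.

(** Rows of the pencil with infinite parameter are unit rows, so its kernel vectors
    are those of the reduced matrix, extended by zero. *)
Lemma det_Gamma_eq0 (R : realType) (N : nat) (a : 'I_N -> ext R[i])
    (Y : 'I_N -> 'rV[R]_3) (z : R[i]) :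
  det_Gamma a Y z = 0 <->
  \det (pencil (interaction Y z) (row_lam a (base_point a)) (row_mu a (base_point a))) = 0.
Proof.
set S := finite_idx a.
pose idx (i : 'I_#|S|) : 'I_N := enum_val i.
have idxS i : a (idx i) != None by exact: (enum_valP i).
rewrite /det_Gamma; set G := Gamma _ _ z.
set M := pencil _ _ _.
have GM (v : 'I_N -> R[i]) : (forall j, a j = None -> v j = 0) ->
    forall i, \sum_l G i l * v (idx l) = - \sum_j M (idx i) j * v j.
  move=> v0 i; rewrite pencil_mulE /row_lam /row_mu idxS /base_point mul1r.
  have -> : \sum_l interaction Y z (idx i) l * v l =
      \sum_l interaction Y z (idx i) (idx l) * v (idx l).
    rewrite -(big_enum_val (A := S) (fun l => interaction Y z (idx i) l * v l)) /=.
    rewrite [RHS]big_mkcond; apply: eq_bigr => l _; case: ifP => //.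
    by rewrite unfold_in /= => /negbT; rewrite negbK => /eqP al; rewrite v0 ?mulr0.
  rewrite opprD mulNr opprK -sumrN.
  rewrite -[odflt 0 _ * _](sum_delta i (fun l => odflt 0 (a (idx i)) * v (idx l))).
  rewrite -big_split; apply: eq_bigr => l _ /=.
  rewrite !mxE (inj_eq enum_val_inj) eq_sym.
  by case: (l == i); rewrite ?mulr1n ?mulr0n; ring.
split=> /det_eq0P [v [j vj] ker]; apply/det_eq0P; last first.
  have v0 j' : a j' = None -> v j' = 0.
    move=> aj; have := ker j'.
    by rewrite pencil_mulE /row_lam /row_mu /base_point aj /= mul1r mul0r addr0.
  exists (v \o idx).
    have aj : j \in S.
      by rewrite unfold_in /=; apply: contraNneq vj => /v0 ->.
    by exists (enum_rank_in aj j); rewrite /= /idx enum_rankK_in.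
  by move=> i; rewrite GM // ker oppr0.
pose w j := \sum_(i < #|S|) v i *+ (idx i == j).
have wE i : w (idx i) = v i.
  by rewrite -[RHS](sum_delta i v); apply: eq_bigr => l _; rewrite (inj_eq enum_val_inj).
have w0 j' : a j' = None -> w j' = 0.
  move=> aj; rewrite /w big1 // => i _.
  by have [e|//] := eqVneq (idx i) j'; have := idxS i; rewrite e aj.
exists w; first by exists (idx j); rewrite wE.
move=> j'; have [aj|aj] := eqVneq (a j') None.
  by rewrite pencil_mulE /row_lam /row_mu /base_point aj /= w0 // mulr0 mul0r addr0.
have jS : j' \in S by [].
have -> : j' = idx (enum_rank_in jS j') by rewrite /idx enum_rankK_in.
rewrite -[LHS]opprK -GM // -[RHS]oppr0; congr (- _).
by rewrite -[RHS](ker (enum_rank_in jS j')); apply: eq_bigr => l _; rewrite wE.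
Qed.

(** The real pair [(lam, mu)] encodes the parameter [alpha = - lam / mu]. *)
Lemma real_pencil_resonance (R : realType) (N : nat) (Y : 'I_N -> 'rV[R]_3)
    (lam mu : 'I_N -> R) (z : R[i]) :
  complex.Im z <= 0 -> (forall j, (lam j != 0) || (mu j != 0)) ->
  \det (pencil (interaction Y z) (fun j => (lam j)%:C) (fun j => (mu j)%:C)) = 0 ->
  Sigma_res_real Y z.
Proof.
move=> z0 nz /det_eq0P [v v0 ker].
pose a j : option R := if mu j == 0 then None else Some (- lam j / mu j).
exists a => //; split; last first.
  by move: z0; rewrite le_eqVlt => /orP[/eqP|]; [right|left].
apply/det_Gamma_eq0/det_eq0P; exists v => // j.
have := ker j; rewrite !pencil_mulE /row_lam /row_mu /base_point /ext_real_complex /a.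
have [m0|m0] := eqVneq (mu j) 0 => /=.
  have := nz j; rewrite m0 eqxx orbF => l0.
  rewrite (rmorph0 (real_complex R)) !mul0r addr0 mul1r => /eqP.
  rewrite mulf_eq0 (fmorph_eq0 (real_complex R)) (negbTE l0).
  by move=> /eqP ->; rewrite addr0.
have mC : (mu j)%:C != 0 by rewrite (fmorph_eq0 (real_complex R)).
have -> : (- lam j / mu j)%:C = - (lam j)%:C / (mu j)%:C.
  by rewrite fmorph_div /= rmorphN.
move: (\sum_l _) (v j) mC => t u mC h; apply: (mulfI mC).
by rewrite mulr0 -[RHS]h; field.
Qed.

Lemma derive1_affine (K : numFieldType) (c0 c1 x : K) :
  derive1 (fun t : K => c0 + c1 * t : K^o) x = c1.
Proof.
rewrite derive1E.
have h : is_derive x (1 : K) (fun t : K => c0 + c1 * t : K^o) (0 + c1 *: 1).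
  by apply: is_deriveD; apply: is_deriveZ.
by rewrite derive_val add0r /GRing.scale /= mulr1.
Qed.

(** [dir_lam] and [dir_mu] are the derivatives of [row_lam] and [row_mu] with
    respect to [beta j]. *)
Definition dir_lam (F : pzRingType) (T : eqType) (N : nat) (a : 'I_N -> option T)
  (j : 'I_N) : F := if a j != None then -1 else 0.

Definition dir_mu (F : pzRingType) (T : eqType) (N : nat) (a : 'I_N -> option T)
  (j : 'I_N) : F := if a j != None then 0 else 1.

Lemma cpartial_reg_det (R : realType) (N : nat) (a : 'I_N -> ext R[i])
    (Y : 'I_N -> 'rV[R]_3) (k : R[i]) (b : 'I_N -> R[i]) j :
  cpartial (fun beta => reg_det a Y beta k) j b =
  (-1) ^+ #|finite_idx a| *
  \det (pencil (interaction Y k) [eta row_lam a b with j |-> dir_lam R[i] a j]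
                                 [eta row_mu a b with j |-> dir_mu R[i] a j]).
Proof.
rewrite /cpartial.
set e := (-1) ^+ _; set D := \det _.
pose D0 := \det (pencil (interaction Y k) (row_lam a b) (row_mu a b)).
have -> : (fun t : R[i] => reg_det a Y [eta b with j |-> t] k : R[i]^o) =
    (fun t => (e * (D0 - b j * D)) + (e * D) * t).
  apply/funext => t; rewrite reg_det_pencil -/e.
  have -> : \det (pencil (interaction Y k) (row_lam a [eta b with j |-> t])
        (row_mu a [eta b with j |-> t])) =
      D0 + (t - b j) * D.
    rewrite /D0 /D -det_pencil_rowD; congr (\det _); apply: eq_pencil => i;
      rewrite /row_lam /row_mu /dir_lam /dir_mu /=;
      case: (eqVneq i j) => // ->; case: (a j != None); ring.
  by rewrite mulrDr mulrBl; ring.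
exact: (@derive1_affine (Cnum R)).
Qed.

(** * Common rays and lines *)
Lemma polar_form (R : realType) (w : R[i]) :
  exists (xi r : R), [/\ - pi <= xi < pi, 0 <= r & w = cexp ('i%C * xi%:C) * r%:C].
Proof.
have cexpE (xi : R) : cexp ('i%C * xi%:C) = cos xi +i* sin xi.
  rewrite /cexp (_ : 'i%C * xi%:C = 0 +i* xi) /= ?expR0; last first.
    by apply/eqP; rewrite eq_complex /=; apply/andP; split; apply/eqP; ring.
  by apply/eqP; rewrite eq_complex /=; apply/andP; split; apply/eqP; ring.
have pi0 := pi_gt0 R.
have [->|w0] := eqVneq w 0.
  by exists (- pi), 0; split; rewrite ?mulr0 // lexx /=; lra.
pose n := complex.Re w ^+ 2 + complex.Im w ^+ 2.
have n0 : 0 < n by exact: Re2Im2_gt0.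
pose r := Num.sqrt n.
have r0 : 0 < r by rewrite sqrtr_gt0.
have r2 : r ^+ 2 = n by rewrite sqr_sqrtr // ltW.
pose c := complex.Re w / r; pose s := complex.Im w / r.
have cs : c ^+ 2 + s ^+ 2 = 1.
  by rewrite /c /s !expr_div_n -mulrDl r2 divff // gt_eqF.
have c1 : -1 <= c <= 1.
  rewrite -ler_norml -(@ler_pXn2r _ 2) ?nnegrE // expr1n real_normK ?num_real //.
  by have := sqr_ge0 s; lra.
have wE xi : cos xi = c -> sin xi = s -> w = cexp ('i%C * xi%:C) * r%:C.
  move=> e1 e2; rewrite cexpE e1 e2 /c /s; case: (w) => x y.
  by apply/eqP; rewrite eq_complex /=; apply/andP; split; apply/eqP; field; rewrite gt_eqF.
have cA : cos (acos c) = c by exact: acosK.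
have sA : sin (acos c) = `|s|.
  by rewrite sin_acos // -sqrtr_sqr; congr Num.sqrt; lra.
have aI : 0 <= acos c <= pi by rewrite acos_ge0 // acos_lepi.
have [s0|s0] := leP 0 s.
  (* The angle pi has to be written - pi. *)
  have [ep|np] := eqVneq (acos c) pi.
    exists (- pi), r; split; [by rewrite lexx /=; lra|exact: ltW|apply: wE].
      by rewrite cosN -ep.
    rewrite sinN -ep sA; move: sA; rewrite ep sinpi => /esym/eqP.
    by rewrite normr_eq0 => /eqP ->; rewrite normr0 oppr0.
  exists (acos c), r; split; [|exact: ltW|apply: wE => //; by rewrite sA ger0_norm].
  by case/andP: aI => a1 a2; apply/andP; split; [lra|rewrite lt_neqAle np].
exists (- acos c), r; split; [|exact: ltW|apply: wE].
- have a0 : acos c != 0.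
    apply/eqP => a0; move: sA; rewrite a0 sin0 => /esym/eqP.
    by rewrite normr_eq0 => /eqP s1; rewrite s1 ltxx in s0.
  case/andP: aI => ge0 lepi; have : 0 < acos c by rewrite lt_neqAle eq_sym a0.
  by move=> gt0; apply/andP; split; lra.
- by rewrite cosN.
- by rewrite sinN sA ltr0_norm // opprK.
Qed.

Lemma common_ray (R : realType) (I : Type) (d : I -> R[i]) (w : R[i]) (t : I -> R) :
  (forall j, 0 <= t j) -> (forall j, d j = w * (t j)%:C) ->
  exists2 xi : R, - pi <= xi < pi & forall j, ray xi (d j).
Proof.
move=> t0 dE; have [xi [r [xi_pi r0 wE]]] := polar_form w.
exists xi => // j; exists (r * t j); first by rewrite mulr_ge0.
by rewrite dE wE rmorphM mulrA.
Qed.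

Lemma common_line (R : realType) (I : Type) (d : I -> R[i]) (w : R[i]) (t : I -> R) :
  (forall j, d j = w * (t j)%:C) ->
  exists2 xi : R, - pi <= xi < pi & forall j, line xi (d j).
Proof.
move=> dE; have [xi [r [xi_pi _ wE]]] := polar_form w.
by exists xi => // j; exists (r * t j); rewrite dE wE rmorphM mulrA.
Qed.

(** * Resonances near a given one *)
(** The determinant [x mu - y lam = -1] keeps the shifted pair nonzero and ties its
    dissipation to the imaginary part of the shift. *)
Lemma shifted_pair (R : realType) (lam mu x y : R) (s : R[i]) :
  x * mu - y * lam = -1 ->
  let p := lam%:C + s * x%:C in let q := mu%:C + s * y%:C in
  ((p != 0) || (q != 0)) /\ complex.Im (p * q^*) = - complex.Im s.
Proof.
move=> W p q; split; last first.
  have -> : - complex.Im s = (x * mu - y * lam) * complex.Im s by rewrite W mulN1r.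
  by rewrite /p /q; case: s {p q} => ? ? /=; ring.
rewrite -negb_and; apply/negP => /andP[/eqP p0 /eqP q0].
have : x%:C * q - y%:C * p = (-1)%:C.
  by rewrite -W rmorphB !rmorphM /p /q; ring.
rewrite p0 q0 !mulr0 subr0 => /complexI h.
by have := oner_eq0 R; rewrite -(opprK 1) -h oppr0 eqxx.
Qed.

Lemma shift2_pairs (R : realType) (n : nat) (lam mu x y : 'I_n -> R) j l (s t : R[i]) :
  (forall i, x i * mu i - y i * lam i = -1) ->
  (forall i, (lam i != 0) || (mu i != 0)) ->
  let p := shift2 (fun i => (lam i)%:C) (fun i => (x i)%:C) j l s t in
  let q := shift2 (fun i => (mu i)%:C) (fun i => (y i)%:C) j l s t in
  (forall i, (p i != 0) || (q i != 0)) /\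
  (forall sg, sg * complex.Im s <= 0 -> sg * complex.Im t <= 0 ->
     forall i, 0 <= sg * complex.Im (p i * (q i)^*)).
Proof.
move=> W nz p q; split=> [i|sg sj sl i]; rewrite /p /q /shift2 /=.
  case: (eqVneq i j) => [_|_]; first by have [] := shifted_pair s (W j).
  case: (eqVneq i l) => [_|_]; first by have [] := shifted_pair t (W l).
  by have := nz i; rewrite !(fmorph_eq0 (real_complex R)).
case: (eqVneq i j) => [_|_].
  by have [_ ->] := shifted_pair s (W j); rewrite mulrN oppr_ge0.
case: (eqVneq i l) => [_|_].
  by have [_ ->] := shifted_pair t (W l); rewrite mulrN oppr_ge0.
by rewrite /= !(oppr0, mulr0, mul0r, addr0).
Qed.

(** The derivative of the determinant when row [j] moves in the direction [(x, y)]. *)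
Definition row_deriv (R : realType) (N : nat) (Y : 'I_N -> 'rV[R]_3)
    (lam mu x y : 'I_N -> R) (k : R[i]) (j : 'I_N) : R[i] :=
  \det (pencil (interaction Y k)
    [eta (fun i => (lam i)%:C) with j |-> (x j)%:C]
    [eta (fun i => (mu i)%:C) with j |-> (y j)%:C]).

Lemma continuous_char (R : realType) (N : nat) (Y : 'I_N -> 'rV[R]_3)
    (lam mu : 'I_N -> R[i]) :
  continuous (fun z : Cnum R => \det (pencil (interaction Y z) lam mu) : Cnum R).
Proof.
apply: (@continuous_det_pencil (Cnum R) (Cnum R)) => j l; exact: continuous_interaction.
Qed.

Lemma noncollinear_interior (R : realType) (N : nat) (Y : 'I_N -> 'rV[R]_3)
    (lam mu x y : 'I_N -> R) (k : Cnum R) j l :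
  (forall i, x i * mu i - y i * lam i = -1) ->
  (forall i, (lam i != 0) || (mu i != 0)) ->
  complex.Im (k : R[i]) < 0 ->
  \det (pencil (interaction Y k) (fun i => (lam i)%:C) (fun i => (mu i)%:C)) = 0 ->
  complex.Im (row_deriv Y lam mu x y k l * (row_deriv Y lam mu x y k j)^*) != 0 ->
  nbhs k (Sigma_res_real Y : set (Cnum R)).
Proof.
move=> W nz kneg D0 nc.
have jl : j != l.
  by apply: contraNneq nc => ->; rewrite mulcJ_real.
have near_zero := bilinear_real_zero
  (@continuous_char _ _ Y _ _) (@continuous_char _ _ Y _ _)
  (@continuous_char _ _ Y _ _) (@continuous_char _ _ Y
    [eta (fun i => (lam i)%:C) with j |-> (x j)%:C, l |-> (x l)%:C]
    [eta (fun i => (mu i)%:C) with j |-> (y j)%:C, l |-> (y l)%:C]) D0 nc.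
have near_neg : \forall z \near k, complex.Im (z : R[i]) < 0.
  exact: (cvgr_lt _ (@continuous_Im R k) _ kneg).
apply: filterS2 near_zero near_neg => z [s [t Dz]] zneg.
have := det_pencil_shift2 (interaction Y z) (fun i => (lam i)%:C) (fun i => (mu i)%:C)
  (fun i => (x i)%:C) (fun i => (y i)%:C) s%:C t%:C jl.
rewrite Dz => D1.
have [nz' _] := shift2_pairs j l s%:C t%:C W nz.
have shiftR (u v : 'I_N -> R) i :
    shift2 (fun i => (u i)%:C) (fun i => (v i)%:C) j l s%:C t%:C i =
    (shift2 u v j l s t i)%:C.
  by rewrite /shift2 /=; case: ifP => _; [|case: ifP => _ //]; rewrite rmorphD rmorphM.
apply: (@real_pencil_resonance _ _ _ (shift2 lam x j l s t) (shift2 mu y j l s t)).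
- exact: ltW.
- by move=> i; have := nz' i; rewrite !shiftR !(fmorph_eq0 (real_complex R)).
- rewrite -[RHS]D1; congr (\det _); apply: eq_pencil => i; exact/esym/shiftR.
Qed.

Lemma nonray_dissipative (R : realType) (N : nat) (Y : 'I_N -> 'rV[R]_3)
    (lam mu x y : 'I_N -> R) (k : Cnum R) (sg : R) j l :
  (forall i, x i * mu i - y i * lam i = -1) ->
  (forall i, (lam i != 0) || (mu i != 0)) ->
  sg != 0 ->
  \det (pencil (interaction Y k) (fun i => (lam i)%:C) (fun i => (mu i)%:C)) = 0 ->
  row_deriv Y lam mu x y k j != 0 ->
  ~ (exists2 r : R, 0 <= r &
       row_deriv Y lam mu x y k l = row_deriv Y lam mu x y k j * r%:C) ->
  \forall z \near k, exists la m : 'I_N -> R[i],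
    [/\ forall i, (la i != 0) || (m i != 0),
        forall i, 0 <= sg * complex.Im (la i * (m i)^*) &
        \det (pencil (interaction Y z) la m) = 0].
Proof.
move=> W nz sg0 D0 dj0 noray.
have jl : j != l.
  by apply/eqP => e; apply: noray; exists 1; rewrite ?ler01 // e mulr1.
have sgN : - sg != 0 by rewrite oppr_eq0.
have near_zero := bilinear_half_plane_zero
  (@continuous_char _ _ Y _ _) (@continuous_char _ _ Y _ _)
  (@continuous_char _ _ Y _ _) (@continuous_char _ _ Y
    [eta (fun i => (lam i)%:C) with j |-> (x j)%:C, l |-> (x l)%:C]
    [eta (fun i => (mu i)%:C) with j |-> (y j)%:C, l |-> (y l)%:C]) sgN D0 dj0 noray.
apply: filterS near_zero => z [s [t [s_sg t_sg Dz]]].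
have [nz' diss] := shift2_pairs j l s t W nz.
exists (shift2 (fun i => (lam i)%:C) (fun i => (x i)%:C) j l s t),
  (shift2 (fun i => (mu i)%:C) (fun i => (y i)%:C) j l s t); split; [exact: nz'| |].
  by apply: diss; rewrite -oppr_ge0 -mulNr.
by rewrite det_pencil_shift2.
Qed.

(** Just above [f - i r] there are dissipative zeros; making their parameters real
    only moves them further up. *)
Lemma nonray_smaller_decay (R : realType) (N : nat) (Y : 'I_N -> 'rV[R]_3)
    (lam mu x y : 'I_N -> R) (f r : R) j l :
  injective Y ->
  (forall i, x i * mu i - y i * lam i = -1) ->
  (forall i, (lam i != 0) || (mu i != 0)) ->
  0 < r ->
  \det (pencil (interaction Y (f -i* r)) (fun i => (lam i)%:C) (fun i => (mu i)%:C)) = 0 ->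
  row_deriv Y lam mu x y (f -i* r) j != 0 ->
  ~ (exists2 c : R, 0 <= c &
       row_deriv Y lam mu x y (f -i* r) l = row_deriv Y lam mu x y (f -i* r) j * c%:C) ->
  exists r', [/\ 0 <= r', r' < r & Sigma_res_real Y (f -i* r')].
Proof.
move=> Yinj W nz r0 D0 dj0 noray.
(* Im T f has the sign of f, which decides which half-plane is dissipative. *)
pose sg : R := if 0 <= f then 1 else -1.
have sg0 : sg != 0 by rewrite /sg; case: ifP; rewrite ?oppr_eq0 oner_neq0.
have near_k := @nonray_dissipative _ _ Y lam mu x y (f -i* r) sg j l W nz sg0 D0 dj0 noray.
have cpath : continuous (fun t : R => (f -i* t) : Cnum R).
  apply: continuous_complex; first exact: continuous_cst.
  by apply: continuous_oppf; exact: continuous_idf.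
have [e /= e0 he] := cpath r _ near_k.
pose d := Num.min (e / 2) r.
have d0 : 0 < d by rewrite lt_min r0 divr_gt0.
have dr : d <= r by rewrite ge_min lexx orbT.
have de : d < e.
  by rewrite (@le_lt_trans _ _ (e / 2)) ?ge_min ?lexx // ltr_pdivrMr // ltr_pMr // ltr1n.
have rd : 0 <= r - d by rewrite subr_ge0.
have [|la [m [nz' diss D1]]] := he (r - d).
  by rewrite /ball /= opprB addrC subrK gtr0_norm.
have psd := @interaction_psd _ _ Y f Yinj.
have [r1 [la' [m' [/andP[r10 r1d] nzR D2]]]] :=
  dissipative_to_real (@continuous_interaction _ _ Y) (@interaction_sym _ _ Y)
    sg0 psd rd nz' diss D1.
exists r1; split=> //; first by apply: le_lt_trans r1d _; lra.
by apply: real_pencil_resonance nzR D2; rewrite /= oppr_le0.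
Qed.

Unset Implicit Arguments.

Theorem theorem6p3 (R : realType) (N : nat) (Y : 'I_N -> 'rV[R]_3)
    (Y_inj : injective Y) :
  (forall (a : 'I_N -> ext R) (k : R[i]),
     minimal_decay Y (complex.Re k) k a ->
     exists2 xi : R, - pi <= xi < pi &
       forall j : 'I_N,
         ray xi (cpartial (fun beta => reg_det (ext_real_complex a) Y beta k) j
                   (base_point (ext_real_complex a))))
  /\
  (forall (a : 'I_N -> ext R) (k : R[i]),
     Sigma_res (ext_real_complex a) Y k ->
     bd (Sigma_res_real Y) k ->
     exists2 xi : R, - pi <= xi < pi &
       forall j : 'I_N,
         line xi (cpartial (fun beta => reg_det (ext_real_complex a) Y beta k) j
                    (base_point (ext_real_complex a)))).
Proof.
pose br (a : 'I_N -> ext R) j : R := odflt 0 (a j).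
pose lam a := row_lam a (br a); pose mu a := row_mu a (br a).
pose x (a : 'I_N -> ext R) := dir_lam R a; pose y (a : 'I_N -> ext R) := dir_mu R a.
have W a i : x a i * mu a i - y a i * lam a i = -1.
  by rewrite /x /y /mu /lam /dir_lam /dir_mu /row_mu /row_lam; case: (a i != None); ring.
have nz a i : (lam a i != 0) || (mu a i != 0).
  by rewrite /mu /lam /row_mu /row_lam; case: (a i != None); rewrite oner_neq0 ?orbT.
have finE a i : (ext_real_complex a i != None) = (a i != None).
  by rewrite /ext_real_complex; case: (a i).
have brE a i : base_point (ext_real_complex a) i = (br a i)%:C.
  by rewrite /base_point /ext_real_complex /br; case: (a i).
have lamE a i :
    row_lam (ext_real_complex a) (base_point (ext_real_complex a)) i = (lam a i)%:C.
  by rewrite /row_lam finE brE /lam /row_lam; case: ifP => _; rewrite ?rmorphN ?rmorph1.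
have muE a i : row_mu (ext_real_complex a) (base_point (ext_real_complex a)) i = (mu a i)%:C.
  by rewrite /row_mu finE brE /mu /row_mu; case: ifP => _; rewrite ?rmorph1.
have derivE a k j : cpartial (fun beta => reg_det (ext_real_complex a) Y beta k) j
      (base_point (ext_real_complex a)) =
    (-1) ^+ #|finite_idx (ext_real_complex a)| * row_deriv Y (lam a) (mu a) (x a) (y a) k j.
  rewrite cpartial_reg_det; congr (_ * \det _); apply: eq_pencil => i /=.
    rewrite lamE /dir_lam finE /x /dir_lam; case: ifP => // _.
    by case: ifP => _; rewrite ?rmorphN ?rmorph1 ?rmorph0.
  rewrite muE /dir_mu finE /y /dir_mu; case: ifP => // _.
  by case: ifP => _; rewrite ?rmorph1 ?rmorph0.
have D0 a k : Sigma (ext_real_complex a) Y k ->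
    \det (pencil (interaction Y k) (fun i => (lam a i)%:C) (fun i => (mu a i)%:C)) = 0.
  move/det_Gamma_eq0 => D; rewrite -[RHS]D; congr (\det _).
  by apply: eq_pencil => i; rewrite ?lamE ?muE.
have real_ray a k : complex.Im k = 0 -> Sigma (ext_real_complex a) Y k ->
    exists (w : R[i]) (t : 'I_N -> R), (forall j, 0 <= t j) /\
      forall j, row_deriv Y (lam a) (mu a) (x a) (y a) k j = w * (t j)%:C.
  move=> k0 /D0; have -> : k = (complex.Re k)%:C by rewrite [LHS]complexE k0 mulr0 addr0.
  move=> D.
  pose sg : R := if 0 <= complex.Re k then 1 else -1.
  have sg0 : sg != 0 by rewrite /sg; case: ifP; rewrite ?oppr_eq0 oner_neq0.
  have psd := @interaction_psd _ _ Y (complex.Re k) Y_inj.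
  have [g [c gc]] := real_pencil_ray sg0 (interaction_sym Y _) psd (nz a) D.
  exists (- g), (fun j => c j ^+ 2); split=> j; first exact: sqr_ge0.
  by rewrite /row_deriv gc W mulrN1 rmorphN mulrN mulNr.
split=> [a k [_ kE [Dk kI]]|a k [Dk kI] kbd].
  suff [w [t [t0 wt]]] : exists (w : R[i]) (t : 'I_N -> R), (forall j, 0 <= t j) /\
      forall j, row_deriv Y (lam a) (mu a) (x a) (y a) k j = w * (t j)%:C.
    by apply: (common_ray (w := (-1) ^+ #|finite_idx (ext_real_complex a)| * w) t0) => j;
      rewrite derivE wt mulrA.
  case: kI => /= [kneg|]; last by move/real_ray; apply.
  set d := row_deriv Y (lam a) (mu a) (x a) (y a) k.
  have [[j dj]|alld0] := pselect (exists j, d j != 0); last first.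
    exists 0, (fun=> 0); split=> // j; rewrite mul0r; apply/eqP.
    by apply: contrapT => /negP dj; apply: alld0; exists j.
  have [allray|noray] := pselect (forall l, exists2 r : R, 0 <= r & d l = d j * r%:C).
    have /choice [t tP] : forall l, exists r : R, 0 <= r /\ d l = d j * r%:C.
      by move=> l; have [r r0 e] := allray l; exists r.
    by exists (d j), t; split=> l; have [] := tP l.
  have [l nol] : exists l, ~ exists2 r : R, 0 <= r & d l = d j * r%:C.
    by apply: contrapT => h; apply: noray => l; apply: contrapT => hl; apply: h; exists l.
  pose r := - complex.Im k.
  have r0 : 0 < r by rewrite oppr_gt0.
  have kr : k = complex.Re k -i* r by rewrite /r opprK; case: (k).
  have rmin : r = r_min Y (complex.Re k) by rewrite /r kE /= opprK.
  have := D0 _ _ Dk; move: dj nol; rewrite /d kr => dj nol D.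
  have [r' [r'0 r'r Sr']] := nonray_smaller_decay Y_inj (W a) (nz a) r0 D dj nol.
  have : r_min Y (complex.Re k) <= r'.
    apply: ge_inf; last by split.
    by exists 0 => u [].
  by rewrite -rmin leNgt r'r.
suff [w [t wt]] : exists (w : R[i]) (t : 'I_N -> R),
    forall j, row_deriv Y (lam a) (mu a) (x a) (y a) k j = w * (t j)%:C.
  by apply: (common_line (w := (-1) ^+ #|finite_idx (ext_real_complex a)| * w) (t := t)) => j;
    rewrite derivE wt mulrA.
case: kI => /= [kneg|]; last by move=> /real_ray/(_ Dk) [w [t [_ wt]]]; exists w, t.
set d := row_deriv Y (lam a) (mu a) (x a) (y a) k.
have col j l : complex.Im (d l * (d j)^*) = 0.
  apply/eqP; apply: contrapT => /negP nc.
  have [_ notint] := kbd; apply: notint.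
  exact: (noncollinear_interior (W a) (nz a) kneg (D0 _ _ Dk) nc).
have [[j dj]|alld0] := pselect (exists j, d j != 0); last first.
  exists 0, (fun=> 0) => j; rewrite mul0r; apply/eqP.
  by apply: contrapT => /negP dj; apply: alld0; exists j.
have /choice [t tP] : forall l, exists r : R, d l + d j * r%:C = 0.
  by move=> l; exact: real_ratio dj (col j l).
exists (d j), (fun l => - t l) => l.
by rewrite rmorphN mulrN; apply/eqP; rewrite -addr_eq0 tP.
Qed.
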